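(* Let $k\in\mathbb{N}$. Let $\mu$ be a partition of $m$. Suppose that $m$ is odd and that $n=|\mathrm{CS}(\mu,k)|$, with $n\ge1$. Let $d=mn/k$ and let $E$ be a $d$-dimensional complex vector space. Then there is, up to scalar multiplication, a unique (non-zero) polynomial invariant of degree $n$ for the action of $\mathrm{SL}(E)$ on $\nabla^\mu(E)$.
   Context: $\mathrm{CS}(\mu,k)$ is the set of $\mu$-tableaux with entries from $\{1,\ldots,k\}$ whose rows are strictly increasing and whose columns are weakly increasing. ($d=mn/k$ is then an integer.) $\nabla^\mu$ is the Schur functor for the partition $\mu$, so $\nabla^\mu(E)$ is a polynomial representation of $\mathrm{GL}(E)$ with character the Schur function $s_\mu$. The $n$th component of the coordinate ring $\mathcal{O}(\nabla^\mu(E))$ is taken to be $\mathrm{Sym}^n\nabla^\mu(E)$; polynomial invariants of degree $n$ are the $\mathrm{SL}(E)$-invariant elements of this component. *)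

(* Defs.v *)
From mathcomp Require Export all_boot all_order all_algebra all_fingroup.
From mathcomp Require Export complex reals mpoly.
Set Implicit Arguments.
Unset Strict Implicit.
Unset Printing Implicit Defensive.
Import GRing.Theory.
Local Open Scope ring_scope.

Definition is_partition (m : nat) (mu : seq nat) : Prop :=
  [/\ sorted geq mu, 0%N \notin mu & sumn mu = m].

(* Rows and columns are numbered from 0. *)
Definition box (mu : seq nat) : finType := {i : 'I_(size mu) & 'I_(nth 0%N mu i)}.
Definition row_of (mu : seq nat) (b : box mu) : nat := tag b.
Definition col_of (mu : seq nat) (b : box mu) : nat := tagged b.

(* The entries 1, ..., k are represented by the elements 0, ..., k - 1 of 'I_k. *)
Definition CS (mu : seq nat) (k : nat) : {set {ffun box mu -> 'I_k}} :=
  [set t : {ffun box mu -> 'I_k} |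
     [forall a : box mu, forall b : box mu,
        ((row_of a == row_of b) && (col_of a < col_of b) ==> (t a < t b))%N]
     && [forall a : box mu, forall b : box mu,
        ((col_of a == col_of b) && (row_of a < row_of b) ==> (t a <= t b))%N]].

(* The tensor power of E whose factors are indexed by B, in coordinates: if e
   is the basis vbasis {:E} of E, then x t is the coefficient of the tensor
   product of the basis vectors e`_(t b), for b in B. *)
Definition tensor (K : fieldType) (E : vectType K) (B : finType) : vectType K :=
  {ffun {ffun B -> 'I_(\dim {:E})} -> K^o}.

Definition pure_tensor (K : fieldType) (E : vectType K) (B : finType)
    (v : B -> E) : tensor E B :=
  [ffun t : {ffun B -> 'I_(\dim {:E})} => \prod_b coord (vbasis {:E}) (t b) (v b)].

Definition tensor_act (K : fieldType) (E : vectType K) (B : finType)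
    (g : 'End(E)) (x : tensor E B) : tensor E B :=
  \sum_(t : {ffun B -> 'I_(\dim {:E})})
    x t *: pure_tensor (fun b => g (vbasis {:E})`_(t b)).

Definition row_group (mu : seq nat) : {set {perm box mu}} :=
  [set s : {perm box mu} | [forall b, row_of (s b) == row_of b]].
Definition col_group (mu : seq nat) : {set {perm box mu}} :=
  [set s : {perm box mu} | [forall b, col_of (s b) == col_of b]].

(* Antisymmetrise along the columns, then symmetrise along the rows. *)
Definition polytabloid (K : fieldType) (E : vectType K) (mu : seq nat)
    (v : box mu -> E) : tensor E (box mu) :=
  \sum_(s in col_group mu) \sum_(r in row_group mu)
    (-1) ^+ (s : bool) *: pure_tensor (fun b => v (s (r b))).

(* Weyl's construction of the Schur functor: the image of a Young symmetriser
   on the tensor power of E indexed by the boxes of mu. This is the correct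
   construction in characteristic zero only, since the symmetric powers
   indexed by the rows are realised as spaces of symmetric tensors. *)
Definition nabla (K : fieldType) (mu : seq nat) (E : vectType K) :
    {vspace tensor E (box mu)} :=
  <<[seq polytabloid (fun b => (vbasis {:E})`_(t b))
      | t : {ffun box mu -> 'I_(\dim {:E})}]>>%VS.

(* The symmetric algebra of a subspace U is the polynomial ring in which the
   variable 'X_i stands for the i-th vector of the basis vbasis U. For f
   mapping U linearly to itself, sym_act f is the induced algebra endomorphism. *)
Definition sym_act (K : fieldType) (V : vectType K) (U : {vspace V})
    (f : V -> V) (p : {mpoly K[\dim U]}) : {mpoly K[\dim U]} :=
  comp_mpoly [tuple \sum_(j < \dim U) coord (vbasis U) j (f (vbasis U)`_i) *: 'X_j
             | i < \dim U] p.

Definition in_SL (K : fieldType) (E : vectType K) (g : 'End(E)) : Prop :=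
  \det (\matrix_(i < \dim {:E}, j < \dim {:E})
          coord (vbasis {:E}) i (g (vbasis {:E})`_j)) = 1.

Definition SL_invariant (K : fieldType) (E : vectType K) (mu : seq nat) (n : nat)
    (p : {mpoly K[\dim (nabla mu E)]}) : Prop :=
  p \is n.-homog /\
  forall g : 'End(E), in_SL g -> sym_act (U := nabla mu E) (tensor_act g) p = p.

(* Main.v *)
Require Import Defs.
Import GRing.Theory.
From mathcomp Require Import zify ring spectral.
Import Num.Theory.
Set Implicit Arguments.
Unset Strict Implicit.
Unset Printing Implicit Defensive.
Local Open Scope ring_scope.

(** Write F for a k-dimensional space and M = m n = d k. Wedging in the top
    exterior power of E (x) F pairs the M-th tensor powers of E and F,
    compatibly with GL(E) x GL(F) and up to sign with place permutations. By a
    form of the first fundamental theorem the pairing identifies the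
    det^k-semi-invariants of GL(E) in the first tensor power with the
    det^d-semi-invariants of GL(F) in the second: if P is its matrix then P P^T
    acts on semi-invariants as a nonzero scalar. The sign turns
    Young symmetrisers antisymmetrising columns into ones antisymmetrising rows,
    and, as m is odd, symmetric powers into exterior powers. So SL(E)-invariants
    in Sym^n of the Schur functor correspond to det^d-semi-invariants in the n-th
    exterior power of a space W attached to F. Straightening shows that W has a
    basis indexed by CS(mu, k), so this exterior power is a line, on which
    GL(F) acts by det^d. *)

(** * Polynomial semi-invariants in a tensor power *)

(** Passing to F pays because n is the dimension of W: a symmetric power of the Schur functor
    becomes a top exterior power, where uniqueness is automatic. Up to isomorphism W is the Schur
    functor of the conjugate partition applied to F. The transfer uses the scalar property on both
    sides. Applied to P^T P and GL(F), it shows that the line in the exterior power has non-zero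
    image among the tensors of E; applied to P P^T and GL(E), it shows that every invariant is a
    multiple of that image. The determinant powers are never computed from the constructions. A
    tensor spanning a stable line uses every letter equally often, so in the M-th tensor power the
    exponent can only be M / d = k for GL(E) and M / k = d for GL(F). The same count M = d k turns
    SL-invariance into det^k-semi-invariance, by splitting off a scalar matrix whose entry is a d-th
    root of the determinant. Tensors are functions on words in basis indices, so that place
    permutations become reindexings of words and symmetrisers become explicit sums over
    permutations. *)

Section TensorAction.
Variables (C : comNzRingType) (Q : finType) (d : nat).
Implicit Types (g h : 'M[C]_d) (x : {ffun Q -> 'I_d} -> C) (t : {ffun Q -> 'I_d}).

Definition tact g x t : C := \sum_(s : {ffun Q -> 'I_d}) x s * \prod_q g (s q) (t q).

Lemma eq_tact g x y : x =1 y -> tact g x =1 tact g y.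
Proof. by move=> xy t; apply: eq_bigr => s _; rewrite xy. Qed.

Lemma tactM g h x : tact h (tact g x) =1 tact (g *m h) x.
Proof.
move=> t; rewrite /tact.
transitivity (\sum_(s : {ffun Q -> 'I_d}) \sum_(u : {ffun Q -> 'I_d})
   x u * (\prod_q g (u q) (s q) * \prod_q h (s q) (t q))).
  by apply: eq_bigr => s _; rewrite mulr_suml; apply: eq_bigr => u _; rewrite mulrA.
rewrite exchange_big /=; apply: eq_bigr => u _; rewrite -mulr_sumr; congr (_ * _).
transitivity (\sum_(s : {ffun Q -> 'I_d}) \prod_q (g (u q) (s q) * h (s q) (t q))).
  by apply: eq_bigr => s _; rewrite big_split.
rewrite -(bigA_distr_bigA (fun q j => g (u q) j * h j (t q))).
by apply: eq_bigr => q _; rewrite mxE.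
Qed.

Lemma tactZ c g x t : tact g (fun s => c * x s) t = c * tact g x t.
Proof. by rewrite /tact mulr_sumr; apply: eq_bigr => s _; rewrite mulrA. Qed.

Lemma tact_diag (z : 'rV[C]_d) x t :
  tact (diag_mx z) x t = x t * \prod_q z 0 (t q).
Proof.
rewrite /tact (bigD1 t) //= [X in _ + X]big1 => [|s /eqP st].
  by rewrite addr0; congr (_ * _); apply: eq_bigr => q _; rewrite mxE eqxx.
have [q sq] : exists q, s q != t q.
  apply/existsP; rewrite -negb_forall; apply/negP => /forallP e.
  by apply: st; apply/ffunP => q; apply/eqP.
by rewrite (bigD1 q) //= mxE (negbTE sq) mul0r mulr0.
Qed.

Lemma tact1 x t : tact 1%:M x t = x t.
Proof.
rewrite -diag_const_mx tact_diag big1 ?mulr1 // => q _; by rewrite mxE.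
Qed.

Lemma tact_scale a g x t : tact (a *: g) x t = a ^+ #|Q| * tact g x t.
Proof.
rewrite /tact mulr_sumr; apply: eq_bigr => s _.
under eq_bigr => q _ do rewrite mxE.
by rewrite big_split /= prodr_const mulrCA.
Qed.

End TensorAction.

(* A tensor spanning a line stable under all matrices has constant weight, by
   conjugating diagonal matrices with permutations; trigonalisation then gives
   the character. *)
Section EigenDet.
Variables (C : numClosedFieldType) (Q : finType) (d k : nat).
Hypotheses (d_gt0 : (0 < d)%N) (cardQ : #|Q| = (d * k)%N).
Variables (x : {ffun Q -> 'I_d} -> C) (delta : 'M[C]_d -> C).
Hypothesis eigen : forall g t, tact g x t = delta g * x t.
Variable t0 : {ffun Q -> 'I_d}.
Hypothesis xt0 : x t0 != 0.

Let deltaM g h : delta (g *m h) = delta g * delta h.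
Proof.
apply: (mulIf xt0); rewrite -eigen -tactM.
by rewrite (eq_tact _ (eigen g)) tactZ eigen mulrA.
Qed.

Let delta1 : delta 1%:M = 1.
Proof. by apply: (mulIf xt0); rewrite -eigen tact1 mul1r. Qed.

Let delta_conj p u : p \in unitmx -> delta (invmx p *m u *m p) = delta u.
Proof.
move=> up; rewrite !deltaM mulrAC -deltaM mulVmx // delta1 mul1r //.
Qed.

Lemma delta_diag z t : x t != 0 -> delta (diag_mx z) = \prod_q z 0 (t q).
Proof. by move=> xt; apply: (mulIf xt); rewrite -eigen tact_diag mulrC. Qed.

Lemma delta_diag_perm (s : 'S_d) z : delta (diag_mx (col_perm s z)) = delta (diag_mx z).
Proof.
rewrite -(delta_conj (diag_mx (col_perm s z)) (unitmx_perm C s)); congr delta.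
rewrite -mulmxA; apply: (canLR (mulKmx _)); first exact: unitmx_perm.
rewrite -row_permE -[X in perm_mx X]invgK -col_permE.
apply/matrixP => i j; rewrite !mxE -(inj_eq (@perm_inj _ s)) permKV.
by case: eqP => [->|//].
Qed.

Definition weight_of (t : {ffun Q -> 'I_d}) i := #|[set q | t q == i]|.

(** On this diagonal matrix [delta] is a power of 2 whose exponent is the multiplicity of the letter
    [i], and characteristic zero lets the exponent be read off. *)
Let two_at (i : 'I_d) : 'rV[C]_d := \row_j (if j == i then 2 else 1).

Let prod_two_at (t : {ffun Q -> 'I_d}) i : \prod_q (two_at i) 0 (t q) = 2 ^+ weight_of t i.
Proof.
rewrite (eq_bigr (fun q => if t q == i then 2 else 1 : C)); last by move=> q _; rewrite mxE.
by rewrite -big_mkcond /= prodr_const /weight_of cardsE.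
Qed.

Lemma support_balanced t i : x t != 0 -> weight_of t i = k.
Proof.
move=> xt.
have eqw j : weight_of t j = weight_of t i.
  have: delta (diag_mx (two_at j)) = delta (diag_mx (two_at i)).
    rewrite -(delta_diag_perm (tperm i j) (two_at i)); congr (delta (diag_mx _)).
    apply/rowP => l; rewrite !mxE -[X in _ = if _ == X then _ else _](tpermR i j).
    by rewrite (inj_eq perm_inj).
  rewrite !(delta_diag _ xt) !prod_two_at -!natrX => /eqP.
  by rewrite eqr_nat eqn_exp2l // => /eqP.
have : (\sum_(j < d) weight_of t j = #|Q|)%N.
  rewrite -sum1_card (partition_big t predT) //=; apply: eq_bigr => j _.
  by rewrite /weight_of -sum1_card; apply: eq_bigl => q; rewrite inE.
rewrite (eq_bigr (fun=> weight_of t i)) => [|j _]; last exact: eqw.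
rewrite sum_nat_const card_ord cardQ => /eqP.
by rewrite eqn_mul2l -[d == 0%N]negbK -lt0n d_gt0 => /eqP.
Qed.

Let sum_support t : x t != 0 -> (\sum_q (t q : nat) = \sum_(i < d) k * i)%N.
Proof.
move=> xt; rewrite (partition_big t predT) //=; apply: eq_bigr => i _.
rewrite (eq_bigr (fun=> i : nat)) => [|q /eqP->//].
rewrite sum_nat_const; congr (_ * _)%N.
by rewrite -(support_balanced i xt) /weight_of cardsE; apply: eq_card => q.
Qed.

Let delta_trig u : is_trig_mx u -> delta u = (\det u) ^+ k.
Proof.
move=> trig; have ut := elimT is_trig_mxP trig; apply: (mulIf xt0); rewrite -eigen /tact (bigD1 t0) //=.
rewrite [X in _ + X]big1 ?addr0 => [|s st0].
  rewrite mulrC; congr (_ * _).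
  rewrite (det_trig trig) -prodrXl.
  rewrite (partition_big t0 predT) //=; apply: eq_bigr => i _.
  rewrite (eq_bigr (fun=> u i i)) => [|q /eqP->//].
  rewrite prodr_const; congr (_ ^+ _).
  by rewrite -(support_balanced i xt0) /weight_of cardsE; apply: eq_card => q.
have [->|xs] := eqVneq (x s) 0; first by rewrite mul0r.
(* As [u] is lower triangular, a non-zero term needs [s] to dominate [t0] letter by letter. Both
   words are balanced, hence have the same letter sum, so they coincide. *)
case: (pickP (fun q => s q < t0 q)%N) => [q lt_q|ge].
  by rewrite (bigD1 q) //= ut // mul0r mulr0.
case/eqP: st0; apply/ffunP => q; apply/val_inj/eqP; rewrite eq_sym /=.
have le q' : (t0 q' <= s q' ?= iff (t0 q' == s q' :> nat))%N.
  by split => //; rewrite leqNgt ge.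
have /leqif_sum : forall q', predT q' ->
  (t0 q' <= s q' ?= iff (t0 q' == s q' :> nat))%N by move=> q' _; exact: le.
case=> _; rewrite !sum_support // eqxx => /esym/forallP /(_ q) /=.
by [].
Qed.

Lemma eigen_det g : delta g = (\det g) ^+ k.
Proof.
have [p /unitarymx_unit up trig] := Schur g d_gt0.
have := delta_trig trig; rewrite conjumx //.
have := delta_conj g (p := invmx p); rewrite invmxK unitmx_inv => -> // ->.
by rewrite -mulmxA !det_mulmx det_inv mulrCA mulfV ?mulr1 // -unitfE -unitmxE.
Qed.
End EigenDet.

Lemma base_digits_inj (B N : nat) (f g : 'I_N -> nat) :
  (forall i, f i < B)%N -> (forall i, g i < B)%N ->
  (\sum_i f i * B ^ i = \sum_i g i * B ^ i)%N -> f =1 g.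
Proof.
elim: N f g => [|N IH] f g fB gB; first by move=> _ [].
rewrite !big_ord_recl /= expn0 !muln1.
have shift (h : 'I_N.+1 -> nat) : (\sum_(i < N) h (lift ord0 i) * B ^ lift ord0 i
    = (\sum_(i < N) h (lift ord0 i) * B ^ i) * B)%N.
  by rewrite big_distrl; apply: eq_bigr => i _; rewrite /= /bump add1n expnSr mulnA.
rewrite !shift => E.
have B_gt0 : (0 < B)%N by apply: leq_ltn_trans (fB ord0).
have E0 : f ord0 = g ord0.
  by move/(congr1 (modn^~ B)): E; rewrite ![(_ + _ * B)%N]addnC !modnMDl !modn_small.
have /IH E1 : (\sum_(i < N) f (lift ord0 i) * B ^ i = \sum_(i < N) g (lift ord0 i) * B ^ i)%N.
  by move/eqP: E; rewrite E0 eqn_add2l eqn_pmul2r // => /eqP.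
move=> i; case: (unliftP ord0 i) => [j|] ->; last exact: E0.
exact: E1.
Qed.

Lemma poly_vanish (C : numDomainType) (q : {poly C}) : (forall t, q.[t] = 0) -> q = 0.
Proof.
move=> q0; apply: (@roots_geq_poly_eq0 _ _ [seq i%:R | i <- iota 0 (size q)]).
- by apply/allP => t _; apply/eqP.
- by rewrite map_inj_uniq ?iota_uniq //; apply: mulrIn; rewrite oner_eq0.
- by rewrite size_map size_iota.
Qed.

(* Kronecker substitution reduces to one variable. *)
Lemma mpoly_vanish (C : numDomainType) (N : nat) (p : {mpoly C[N]}) :
  (forall v, p.@[v] = 0) -> p = 0.
Proof.
move=> p0; pose B := msize p.
pose wt (m : 'X_{1..N}) := (\sum_i m i * B ^ i)%N.
pose q : {poly C} := \sum_(m <- msupp p) p@_m *: 'X^(wt m).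
have q0 : q = 0.
  apply: poly_vanish => t; rewrite -[RHS](p0 (fun i => t ^+ (B ^ i))) mevalE.
  rewrite /q horner_sum; apply: eq_bigr => m _; rewrite hornerZ hornerXn; congr (_ * _).
  by rewrite /wt -prodrXr; apply: eq_bigr => i _; rewrite -exprM mulnC.
apply/mpolyP => m; rewrite mcoeff0; case: (boolP (m \in msupp p)) => [mp|]; last first.
  exact: memN_msupp_eq0.
move/(congr1 (fun r : {poly C} => r`_(wt m))): q0; rewrite coef0 /q coef_sum.
rewrite (bigD1_seq m) //= ?msupp_uniq // coefZ coefXn eqxx mulr1 big_seq_cond big1.
  by rewrite addr0.
move=> m' /andP [m'p mm']; rewrite coefZ coefXn; case: eqP => [E|]; last by rewrite mulr0.
have lt (m1 : 'X_{1..N}) (i : 'I_N) : m1 \in msupp p -> (m1 i < B)%N.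
  move=> /msize_mdeg_lt; apply: leq_ltn_trans; rewrite mdegE.
  by rewrite (bigD1 i) //= leq_addr.
case/eqP: mm'; apply/mnmP => i; symmetry.
by apply: (base_digits_inj _ _ E) => j; apply: lt.
Qed.

(** * Place permutations and the first fundamental theorem *)

Definition reindex_word (Q T : finType) (u : {ffun Q -> T}) (p : {perm Q}) :
  {ffun Q -> T} := [ffun q => u (p q)].

Lemma reindex_wordK (Q T : finType) (p : {perm Q}) :
  cancel (fun u : {ffun Q -> T} => reindex_word u p) (fun u => reindex_word u p^-1).
Proof. by move=> u; apply/ffunP => q; rewrite !ffunE permKV. Qed.

Lemma reindex_wordVK (Q T : finType) (p : {perm Q}) :
  cancel (fun u : {ffun Q -> T} => reindex_word u p^-1) (fun u => reindex_word u p).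
Proof. by move=> u; apply/ffunP => q; rewrite !ffunE permK. Qed.

Lemma reindex_word_bij (Q T : finType) (p : {perm Q}) :
  bijective (fun u : {ffun Q -> T} => reindex_word u p).
Proof. exact: Bijective (@reindex_wordK Q T p) (@reindex_wordVK Q T p). Qed.

Lemma reindex_word_eq (Q : finType) (T : finType) (u v : {ffun Q -> T}) :
  (forall y, #|[set q | u q == y]| = #|[set q | v q == y]|) ->
  exists p : {perm Q}, v = reindex_word u p.
Proof.
move=> uv.
have cnt (w : {ffun Q -> T}) y : count_mem y (fgraph w) = #|[set q | w q == y]|.
  rewrite cardE size_filter -codom_ffun /codom /image_mem count_map enumT.
  by apply: eq_count => q /=; rewrite inE.
have /tuple_permP [p E] : perm_eq (fgraph v) (fgraph u).
  by apply/allP => y _ /=; rewrite !cnt uv.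
have f_inj : injective (fun q => enum_val (p (enum_rank q))).
  by move=> q q' /enum_val_inj /perm_inj /enum_rank_inj.
exists (perm f_inj); apply/ffunP => q; rewrite ffunE permE.
have vE : fgraph v = [tuple tnth (fgraph u) (p i) | i < #|Q|] by exact: val_inj.
by have := tnth_fgraph v (enum_rank q); rewrite enum_rankK vE tnth_mktuple tnth_fgraph => ->.
Qed.

(* Semi-invariance is an identity between polynomials in the entries of the group
   element. The kernel [K = P P^T] is invariant under simultaneous place
   permutations, hence a function of the monomials in that identity, so it can be
   applied to it as a linear functional. Positivity of [K] makes the resulting
   scalar nonzero. *)
Section FirstFundamentalTheorem.
Variables (C : numClosedFieldType) (Q : finType) (d k : nat).
Hypotheses (d_gt0 : (0 < d)%N) (cardQ : #|Q| = (d * k)%N).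

Local Notation word := {ffun Q -> 'I_d}.

Let N := (d * d)%N.
Let GX : 'M[{mpoly C[N]}]_d := \matrix_(i, j) 'X_(mxvec_index i j).
Let content (s t : word) : 'X_{1..N} := (\sum_q U_(mxvec_index (s q) (t q)))%MM.

Let content_perm s t s' t' : content s t = content s' t' ->
  exists p, s' = reindex_word s p /\ t' = reindex_word t p.
Proof.
move=> E; pose u (s t : word) := [ffun q => mxvec_index (s q) (t q)].
have cnt (s1 t1 : word) y : content s1 t1 y = #|[set q | u s1 t1 q == y]|.
  rewrite /content mnm_sumE -sum1_card big_mkcond [RHS]big_mkcond /=.
  by apply: eq_bigr => q _; rewrite mnm1E inE ffunE; case: eqP.
have [p /ffunP Ep] : exists p, u s' t' = reindex_word (u s t) p.
  by apply: reindex_word_eq => y; rewrite -!cnt E.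
have Ei q : (s' q, t' q) = (s (p q), t (p q)).
  by have := Ep q; rewrite !ffunE => /cast_ord_inj/enum_rank_inj.
by exists p; split; apply/ffunP => q; rewrite ffunE; case: (Ei q).
Qed.

Let GX_content (s t : word) : \prod_q GX (s q) (t q) = 'X_[content s t].
Proof. by rewrite /content -mprodXE; apply: eq_bigr => q _; rewrite mxE. Qed.

Let meval_GX (g : 'M[C]_d) :
  map_mx (meval (fun l => mxvec g 0 l)) GX = g.
Proof. by apply/matrixP => i j; rewrite !mxE mevalXU mxvecE. Qed.

Let generic (v : 'I_N -> C) : exists g : 'M[C]_d, v =1 (fun l => mxvec g 0 l).
Proof. by exists (vec_mx (\row_l v l)) => l; rewrite vec_mxK mxE. Qed.

Let detX_neq0 : \det GX != 0.
Proof.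
apply/eqP => /(congr1 (meval (fun l => mxvec (1%:M : 'M[C]_d) 0 l))).
rewrite -det_map_mx meval_GX det1 meval0 => /eqP; exact/negP/oner_neq0.
Qed.

Let invariant_generic (x : word -> C) :
  (forall g, g \in unitmx -> forall t, tact g x t = \det g ^+ k * x t) ->
  forall t, \sum_s x s *: 'X_[content s t] = x t *: \det GX ^+ k.
Proof.
(* The hypothesis only covers invertible matrices. The extra factor [\det GX] makes the identity
   true at singular ones too, and is cancelled since polynomials form a domain. *)
move=> inv t; apply/eqP; rewrite -subr_eq0; apply/eqP/(mulIf detX_neq0).
rewrite mul0r; apply: mpoly_vanish => v; have [g vg] := generic v.
rewrite (meval_eq _ vg) mevalM -det_map_mx meval_GX.
have [gu|] := boolP (g \in unitmx); last first.
  by rewrite unitmxE unitfE negbK => /eqP ->; rewrite mulr0.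
rewrite mevalB [X in X - _](_ : _ = tact g x t); last first.
  rewrite raddf_sum; apply: eq_bigr => s _.
  rewrite /= mevalZ -GX_content rmorph_prod; congr (_ * _); apply: eq_bigr => q _ /=.
  by have /matrixP/(_ (s q) (t q)) := meval_GX g; rewrite mxE.
by rewrite mevalZ rmorphXn /= -det_map_mx meval_GX inv // [x t * _]mulrC subrr mul0r.
Qed.

Variables (B : finType) (P : word -> B -> C) (pact : {perm Q} -> B -> B) (delta : 'M[C]_d -> C).
Hypotheses (pact_bij : forall p, bijective (pact p))
  (P_sign : forall p s b, P (reindex_word s p) (pact p b) = (-1) ^+ p * P s b)
  (P_eigen : forall b g t, tact g (P^~ b) t = delta g * P t b)
  (P_real : forall s b, P s b \is Num.real).
Variables (s0 : word) (b0 : B).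
Hypothesis P_neq0 : P s0 b0 != 0.

Let K s t := \sum_b P s b * P t b.

Let K_perm s t p : K (reindex_word s p) (reindex_word t p) = K s t.
Proof.
rewrite /K (reindex (pact p)) /=; last exact: onW_bij.
by apply: eq_bigr => b _; rewrite !P_sign mulrACA -expr2 sqrr_sign mul1r.
Qed.

(** Pairs of words with the same content differ by a simultaneous place permutation, so the choice
    of representative is harmless; 0 is a default for monomials arising from no pair. *)
Let kappa (m : 'X_{1..N}) :=
  if [pick st : word * word | content st.1 st.2 == m] is Some st
  then K st.1 st.2 else 0.

Let kappa_content s t : kappa (content s t) = K s t.
Proof.
rewrite /kappa; case: pickP => [st /eqP E|/(_ (s, t))]; last by rewrite eqxx.
by have [p [-> ->]] := content_perm E; rewrite K_perm.
Qed.

(** The degree bound makes the sum finite and still reaches every [content s t], which has degree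
    [#|Q|]. *)
Let L (p : {mpoly C[N]}) := \sum_(m : 'X_{1..N < #|Q|.+1}) p@_m * kappa m.

Let L_content s t : L 'X_[content s t] = K s t.
Proof.
have lt : (mdeg (content s t) < #|Q|.+1)%N.
  rewrite ltnS /content mdeg_sum (eq_bigr (fun=> 1%N)) => [|q _]; last exact: mdeg1.
  by rewrite sum1_card.
rewrite /L (bigD1 (BMultinom lt)) //= mcoeffX eqxx mul1r kappa_content big1 ?addr0 //.
move=> m /eqP ne; rewrite mcoeffX; case: eqP => [E|]; last by rewrite mul0r.
by case: ne; apply/val_inj.
Qed.

Let c := L (\det GX ^+ k).

Let K_invariant (x : word -> C) :
  (forall g, g \in unitmx -> forall t, tact g x t = \det g ^+ k * x t) ->
  forall t, \sum_b P t b * (\sum_s P s b * x s) = c * x t.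
Proof.
move=> inv t.
transitivity (\sum_s x s * K s t).
  under eq_bigr => b _ do rewrite mulr_sumr.
  rewrite exchange_big /=; apply: eq_bigr => s _; rewrite /K mulr_sumr.
  by apply: eq_bigr => b _; rewrite mulrA mulrC [P t b * _]mulrC.
transitivity (L (\sum_s x s *: 'X_[content s t])).
  rewrite /L; under [RHS]eq_bigr => m _ do rewrite raddf_sum mulr_suml.
  rewrite exchange_big /=; apply: eq_bigr => s _; rewrite -L_content /L mulr_sumr.
  by apply: eq_bigr => m _; rewrite mcoeffZ mulrA.
rewrite (invariant_generic inv) /L /c /L mulr_suml; apply: eq_bigr => m _.
by rewrite mcoeffZ -[LHS]mulrA mulrC.
Qed.

Let c_neq0 : c != 0.
Proof.
(* Let v be the column of P at [b0] and y = P^T v. If [c] were 0 then P y = 0, so the sum of the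
   squares of y, being the product of v with P y, vanishes. As y is real, it is 0; its entry at [b0]
   is the sum of the squares of v, so v = 0. *)
apply/negP => /eqP c0.
have Pinv g t : tact g (P^~ b0) t = \det g ^+ k * P t b0.
  by rewrite P_eigen (eigen_det d_gt0 cardQ (P_eigen b0) P_neq0).
pose y b := \sum_s P s b * P s b0.
have Py t : \sum_b P t b * y b = 0.
  by rewrite (K_invariant (x := P^~ b0)) ?c0 ?mul0r // => g _ u; exact: Pinv.
have y_real b : y b \is Num.real by apply: rpred_sum => s _; rewrite rpredM.
have : \sum_b y b ^+ 2 = 0.
  transitivity (\sum_s P s b0 * \sum_b P s b * y b); last first.
    by rewrite big1 // => s _; rewrite Py mulr0.
  under [RHS]eq_bigr => s _ do rewrite mulr_sumr.
  rewrite exchange_big; apply: eq_bigr => b _; rewrite expr2 {1}/y mulr_suml.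
  by apply: eq_bigr => s _; rewrite mulrA [P s b0 * _]mulrC.
move/(psumr_eq0P (fun b _ => real_exprn_even_ge0 (y_real b) (erefl : ~~ odd 2))).
move=> /(_ b0 isT) /eqP; rewrite expf_eq0 /= /y => /eqP.
under eq_bigr => s _ do rewrite -expr2.
move/(psumr_eq0P (fun s _ => real_exprn_even_ge0 (P_real s b0) (erefl : ~~ odd 2))).
by move=> /(_ s0 isT) /eqP; rewrite expf_eq0 (negbTE P_neq0).
Qed.

Lemma first_fundamental_theorem : exists2 c, c != 0 & forall x : word -> C,
  (forall g, g \in unitmx -> forall t, tact g x t = \det g ^+ k * x t) ->
  forall t, \sum_b P t b * (\sum_s P s b * x s) = c * x t.
Proof. by exists c; [exact: c_neq0 | exact: K_invariant]. Qed.

End FirstFundamentalTheorem.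

(** * Signs of permutations and the wedge pairing *)

(** Write [p] as a product of transpositions; [f] carries each to a transposition of [Q], and these
    are stripped off [p'] one at a time. *)
Lemma odd_perm_embed (Y Q : finType) (f : Y -> Q) (p : {perm Y}) (p' : {perm Q}) :
  injective f -> (forall y, p' (f y) = f (p y)) ->
  (forall q, q \notin codom f -> p' q = q) -> odd_perm p' = odd_perm p.
Proof.
move=> f_inj; have [ts -> _] := prod_tpermP p.
elim: ts p' => [|[a b] ts IH] p' pf p'f.
  rewrite big_nil odd_perm1 (_ : p' = 1%g) ?odd_perm1 //.
  apply/permP => q; rewrite perm1; case: (boolP (q \in codom f)) => [/codomP [y ->]|/p'f //].
  by rewrite pf big_nil perm1.
have swap y : tperm (f a) (f b) (f y) = f (tperm a b y).
  by rewrite !permE /= !(inj_eq f_inj) !(fun_if f).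
rewrite big_cons odd_permM -(IH (tperm (f a) (f b) * p')%g) ?odd_permM ?odd_tperm.
- by rewrite (inj_eq f_inj) addbA addbb.
- by move=> y; rewrite permM swap pf big_cons permM tpermK.
- move=> q qf; rewrite permM tpermD ?p'f //; apply: contraNneq qf => <-; exact: codom_f.
Qed.

Section BlockPerm.
Variables (X Y : finType).

Fact block_perm_inj (s : X -> {perm Y}) :
  injective (fun xy : X * Y => (xy.1, s xy.1 xy.2)).
Proof. by move=> [x y] [x' y'] /= [<- /perm_inj <-]. Qed.

Definition block_perm (s : X -> {perm Y}) : {perm X * Y} := perm (@block_perm_inj s).

Lemma block_permE s x y : block_perm s (x, y) = (x, s x y).
Proof. by rewrite permE. Qed.

(** The permutation is a product of permutations each moving a single block, so the induction runs
    over a list containing every block that moves. *)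
Lemma odd_block_perm (C : pzRingType) (s : X -> {perm Y}) :
  (-1) ^+ block_perm s = \prod_x (-1) ^+ s x :> C.
Proof.
have key : forall r s, uniq r -> (forall x, x \notin r -> s x = 1%g) ->
    (-1) ^+ block_perm s = \prod_(x <- r) (-1) ^+ s x :> C.
  elim=> [|x r IH] {}s /=.
    move=> _ s1; rewrite big_nil (_ : block_perm s = 1%g) ?odd_perm1 //.
    by apply/permP => -[x y]; rewrite block_permE s1 // !perm1.
  case/andP=> xr ur s1.
  pose s' z := if z == x then 1%g else s z.
  pose sx z := if z == x then s x else 1%g.
  have -> : block_perm s = (block_perm sx * block_perm s')%g.
    apply/permP => -[z y]; rewrite permM !block_permE /sx /s'.
    by case: eqP => [->|_]; rewrite perm1.
  rewrite odd_permM signr_addb big_cons; congr (_ * _).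
    congr (_ ^+ (nat_of_bool _)); apply: (@odd_perm_embed _ _ (fun y => (x, y))).
    - by move=> y y' [].
    - by move=> y; rewrite block_permE /sx eqxx.
    - move=> [z y] zy; rewrite block_permE /sx; case: eqP zy => [->|_ _].
        by rewrite codom_f.
      by rewrite perm1.
  rewrite IH //; last by move=> z zr; rewrite /s'; case: eqP => // /eqP zx; apply: s1;
    rewrite inE negb_or zx.
  rewrite big_seq [RHS]big_seq; apply: eq_bigr => z zr; rewrite /s'.
  by case: eqP => // zx; rewrite zx (negPf xr) in zr.
by apply: key => [|x]; rewrite ?index_enum_uniq ?mem_index_enum.
Qed.

Fact left_perm_inj (p : {perm X}) : injective (fun xy : X * Y => (p xy.1, xy.2)).
Proof. by move=> [x y] [x' y'] /= [/perm_inj <- <-]. Qed.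

Definition left_perm (p : {perm X}) : {perm X * Y} := perm (@left_perm_inj p).

Lemma left_permE p x y : left_perm p (x, y) = (p x, y).
Proof. by rewrite permE. Qed.

End BlockPerm.

(** With the coordinates exchanged, this is a block permutation acting by [p] on each of [#|Y|]
    blocks. With [Y] the boxes of mu, an odd number of them, permuting the n factors has the sign of
    [p]. *)
Lemma odd_left_perm (C : pzRingType) (X Y : finType) (p : {perm X}) :
  (-1) ^+ left_perm Y p = ((-1) ^+ p) ^+ #|Y| :> C.
Proof.
rewrite -prodr_const -odd_block_perm; congr (_ ^+ (nat_of_bool _)).
apply: (@odd_perm_embed _ _ (fun yx => (yx.2, yx.1))).
- by move=> [x y] [x' y'] [-> ->].
- by move=> [x y] /=; rewrite left_permE block_permE.
- by move=> [x y]; rewrite (codom_f (fun yx : Y * X => (yx.2, yx.1)) (y, x)).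
Qed.

Section Alternant.
Variables (C : numDomainType) (Q : finType).

(** Leibniz sums for matrices indexed by [Q]: picking the rows of [G] along [w] multiplies the
    determinant by the sign of [w], or by 0 if [w] repeats a row, since a transposition then pairs
    terms of opposite sign. *)
Lemma alternant (w : Q -> Q) (G : Q -> Q -> C) :
  \sum_(p : {perm Q}) (-1) ^+ p * \prod_q G (w q) (p q)
  = (\sum_(p : {perm Q}) (-1) ^+ p * \prod_q (w q == p q)%:R)
    * \sum_(p : {perm Q}) (-1) ^+ p * \prod_q G q (p q).
Proof.
have [/injectiveP w_inj|] := boolP (injectiveb w).
  have wE q : w q = perm w_inj q by rewrite permE.
  set r := perm w_inj in wE.
  rewrite [X in _ = X * _](bigD1 r) //= [X in _ + X]big1 => [|p pr]; last first.
    have [q] : exists q, w q != p q.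
      apply/existsP; rewrite -negb_forall; apply: contra pr => /forallP e.
      by apply/eqP/permP => q; rewrite -wE (eqP (e q)).
    by move=> /negPf wp; rewrite (bigD1 q) //= wp mul0r mulr0.
  rewrite addr0 [X in _ * X * _]big1 ?mulr1 => [|q _]; last by rewrite wE eqxx.
  rewrite mulr_sumr (reindex_inj (mulgI r)) /=; apply: eq_bigr => p _.
  rewrite odd_permM signr_addb mulrA; congr (_ * _).
  rewrite [RHS](reindex_inj (@perm_inj _ r)) /=.
  by apply: eq_bigr => q _; rewrite permM wE.
move=> /injectivePn [a [b ab wab]].
rewrite [X in _ = X * _]big1 ?mul0r => [|p _]; last first.
  have [/forallP e|] := boolP [forall q, w q == p q].
    by case/eqP: ab; apply: (@perm_inj _ p); rewrite -!(eqP (e _)).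
  by rewrite negb_forall => /existsP [q /negPf wp]; rewrite (bigD1 q) //= wp mul0r mulr0.
apply/eqP; rewrite -eqNr -sumrN; apply/eqP.
rewrite [RHS](reindex_inj (mulgI (tperm a b))) /=; apply: eq_bigr => p _.
rewrite odd_permM odd_tperm ab signr_addb expr1 !mulN1r mulNr.
congr (- (_ * _)); rewrite (reindex_inj (@perm_inj _ (tperm a b))) /=.
apply: eq_bigr => q _; rewrite permM; congr (G _ _).
by case: tpermP => // ->.
Qed.
End Alternant.

Section Kernel.
Variables (C : numDomainType) (Q I J : finType) (e : Q -> I * J).

(* The pairing of tensor powers [E^(x)Q] and [F^(x)Q] obtained by wedging in the
   top exterior power of [E (x) F], on basis vectors; [e] orders the basis of
   [E (x) F]. *)
Definition wedge_pairing (s : {ffun Q -> I}) (a : {ffun Q -> J}) : C :=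
  \sum_(p : {perm Q}) (-1) ^+ p * \prod_q ((s q, a q) == e (p q))%:R.

Lemma wedge_pairing_sign p s a :
  wedge_pairing (reindex_word s p) (reindex_word a p) = (-1) ^+ p * wedge_pairing s a.
Proof.
rewrite /wedge_pairing mulr_sumr (reindex_inj (mulgI p)) /=; apply: eq_bigr => r _.
rewrite odd_permM signr_addb mulrA; congr (_ * _).
rewrite [RHS](reindex_inj (@perm_inj _ p)) /=.
by apply: eq_bigr => q _; rewrite permM !ffunE.
Qed.

Lemma wedge_pairing_real s a : wedge_pairing s a \is Num.real.
Proof.
apply: rpred_sum => p _; rewrite rpredM ?rpredX ?rpredN ?rpred1 //.
by apply: rpred_prod => q _; rewrite rpred_nat.
Qed.

Lemma wedge_pairing_neq0 : injective e ->
  wedge_pairing [ffun q => (e q).1] [ffun q => (e q).2] != 0.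
Proof.
move=> e_inj; rewrite /wedge_pairing (bigD1 1%g) //= [X in _ + X]big1 => [|p p1].
  rewrite odd_perm1 mul1r addr0 big1 ?oner_eq0 // => q _.
  by rewrite !ffunE perm1 -surjective_pairing eqxx.
have [q] : exists q, p q != q.
  apply/existsP; rewrite -negb_forall; apply: contra p1 => /forallP h.
  by apply/eqP/permP => q; rewrite perm1 (eqP (h q)).
rewrite (bigD1 q) //= !ffunE -surjective_pairing (inj_eq e_inj) eq_sym => /negPf ->.
by rewrite mul0r mulr0.
Qed.
End Kernel.

Lemma wedge_pairing_swap (C : numDomainType) (Q I J : finType) (e : Q -> I * J) s a :
  wedge_pairing C (fun q => ((e q).2, (e q).1)) a s = wedge_pairing C e s a.
Proof.
apply: eq_bigr => p _; congr (_ * _); apply: eq_bigr => q _; congr (nat_of_bool _)%:R.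
by case: (e (p q)) => i j; rewrite !xpair_eqE andbC.
Qed.

(** An endomorphism of E acts on the top exterior power of E (x) F by a scalar: [delta g] is the
    determinant of g (x) 1 in the basis [e]. Its value as a power of the determinant of [g] comes
    from [eigen_det]. *)
Lemma wedge_pairing_eigen (C : numDomainType) (Q J : finType) (d : nat)
    (e : Q -> 'I_d * J) : bijective e ->
  exists delta : 'M[C]_d -> C, forall a g t,
    tact g ((wedge_pairing C e)^~ a) t = delta g * wedge_pairing C e t a.
Proof.
case=> f ef fe.
pose G (g : 'M[C]_d) q r := g (e r).1 (e q).1 * ((e q).2 == (e r).2)%:R.
exists (fun g => \sum_(p : {perm Q}) (-1) ^+ p * \prod_q G g q (p q)) => a g t.
pose w q := f (t q, a q).
have -> : wedge_pairing C e t a = \sum_(p : {perm Q}) (-1) ^+ p * \prod_q (w q == p q)%:R.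
  apply: eq_bigr => p _; congr (_ * _); apply: eq_bigr => q _.
  by rewrite /w -(inj_eq (can_inj ef)) fe.
rewrite [RHS]mulrC -alternant /tact /wedge_pairing.
under eq_bigr => s _ do rewrite mulr_suml.
rewrite exchange_big /=; apply: eq_bigr => p _.
transitivity ((-1) ^+ p * \sum_(s : {ffun Q -> 'I_d})
   \prod_q (((s q, a q) == e (p q))%:R * g (s q) (t q))).
  by rewrite mulr_sumr; apply: eq_bigr => s _; rewrite -mulrA big_split.
rewrite -(bigA_distr_bigA (fun q i => ((i, a q) == e (p q))%:R * g i (t q))).
congr (_ * _); apply: eq_bigr => q _; rewrite /G /w fe /=.
case: (e (p q)) => i0 j0 /=; rewrite (bigD1 i0) //= big1 => [|i /negPf ne].
  by rewrite addr0 xpair_eqE eqxx mulrC.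
by rewrite xpair_eqE ne mul0r.
Qed.

(** * Tableaux and straightening *)

Lemma reindex_wordM (Q T : finType) (u : {ffun Q -> T}) p r :
  reindex_word (reindex_word u p) r = reindex_word u (r * p)%g.
Proof. by apply/ffunP => q; rewrite !ffunE permM. Qed.

Lemma reindex_word1 (Q T : finType) (u : {ffun Q -> T}) : reindex_word u 1%g = u.
Proof. by apply/ffunP => q; rewrite ffunE perm1. Qed.

Lemma reindex_word_eqV (Q T : finType) (u v : {ffun Q -> T}) p :
  (reindex_word u p == v) = (u == reindex_word v p^-1).
Proof. by apply/eqP/eqP => [<-|->]; rewrite reindex_wordM ?mulVg ?mulgV reindex_word1. Qed.

Section Boxes.
Variable mu : seq nat.
Implicit Types (a b : box mu) (r s : {perm box mu}).

Lemma box_eq a b : row_of a = row_of b -> col_of a = col_of b -> a = b.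
Proof.
case: a b => [i c] [j d]; rewrite /row_of /col_of /= => /val_inj E.
by case: _ / E d => d /val_inj ->.
Qed.

Lemma col_of_lt b : (col_of b < nth 0%N mu (row_of b))%N.
Proof. exact: ltn_ord. Qed.

Lemma box_exists i c : (c < nth 0%N mu i)%N -> exists b, row_of b = i /\ col_of b = c.
Proof.
move=> lt_c; have lt_i : (i < size mu)%N.
  by case: ltnP => // ge; rewrite nth_default in lt_c.
by exists (Tagged (fun i : 'I_(size mu) => 'I_(nth 0%N mu i)) (Ordinal lt_c : 'I_(nth 0%N mu (Ordinal lt_i)))).
Qed.

Lemma row_groupP s : reflect (forall b, row_of (s b) = row_of b) (s \in row_group mu).
Proof. by rewrite inE; apply: (iffP forallP) => h b; apply/eqP; rewrite h. Qed.

Lemma col_groupP s : reflect (forall b, col_of (s b) = col_of b) (s \in col_group mu).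
Proof. by rewrite inE; apply: (iffP forallP) => h b; apply/eqP; rewrite h. Qed.

Fact row_group_set : group_set (row_group mu).
Proof.
apply/group_setP; split=> [|r s /row_groupP hr /row_groupP hs]; apply/row_groupP => b.
  by rewrite perm1.
by rewrite permM hs hr.
Qed.
Canonical row_group_group := Group row_group_set.

Fact col_group_set : group_set (col_group mu).
Proof.
apply/group_setP; split=> [|r s /col_groupP hr /col_groupP hs]; apply/col_groupP => b.
  by rewrite perm1.
by rewrite permM hs hr.
Qed.
Canonical col_group_group := Group col_group_set.

Lemma tperm_row_group a b : row_of a = row_of b -> tperm a b \in row_group mu.
Proof. by move=> ab; apply/row_groupP => x; case: tpermP => // ->. Qed.

Lemma tperm_col_group a b : col_of a = col_of b -> tperm a b \in col_group mu.
Proof. by move=> ab; apply/col_groupP => x; case: tpermP => // ->. Qed.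

(** If [r] is increasing along rows, no box moves to the left; the total of the column numbers is
    preserved, so no box moves at all. *)
Lemma row_group_sorted_eq1 r : r \in row_group mu ->
  (forall a b, row_of a = row_of b -> (col_of a < col_of b)%N ->
     (col_of (r a) < col_of (r b))%N) -> r = 1%g.
Proof.
move=> /row_groupP hr mono.
have ge c b : col_of b = c -> (c <= col_of (r b))%N.
  elim: c b => [//|c IH] b bc.
  have [a [ai ac]] : exists a, row_of a = row_of b /\ col_of a = c.
    by apply: box_exists; have := col_of_lt b; rewrite bc; apply: ltnW.
  by apply: leq_ltn_trans (IH _ ac) (mono _ _ ai _); rewrite ac bc.
have /leqif_sum [_] : forall b, predT b -> (col_of b <= col_of (r b) ?= iff (col_of b == col_of (r b)))%N.
  by move=> b _; split=> //; apply: ge.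
rewrite [X in _ == X](reindex_inj (@perm_inj _ r^-1)) /=.
under [X in _ == X]eq_bigr => b _ do rewrite permKV.
rewrite eqxx => /esym/forallP h; apply/permP => b; rewrite perm1.
by apply: box_eq; rewrite ?hr //; have /eqP <- := h b.
Qed.

End Boxes.

Section Tableaux.
Variables (mu : seq nat) (k : nat).
Local Notation word := {ffun box mu -> 'I_k}.
Implicit Types (a b : box mu) (r s : {perm box mu}) (u v : word).

Definition row_strict u := forall a b,
  row_of a = row_of b -> (col_of a < col_of b)%N -> (u a < u b)%N.
Definition col_weak u := forall a b,
  col_of a = col_of b -> (row_of a < row_of b)%N -> (u a <= u b)%N.

Lemma CSP u : reflect (row_strict u /\ col_weak u) (u \in CS mu k).
Proof.
rewrite inE; apply: (iffP andP) => -[h1 h2]; split.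
- by move=> a b /eqP ab lt; have /forallP/(_ a)/forallP/(_ b) := h1; rewrite ab lt.
- by move=> a b /eqP ab lt; have /forallP/(_ a)/forallP/(_ b) := h2; rewrite ab lt.
- by apply/forallP => a; apply/forallP => b; apply/implyP => /andP [/eqP ab lt]; apply: h1.
- by apply/forallP => a; apply/forallP => b; apply/implyP => /andP [/eqP ab lt]; apply: h2.
Qed.

(** Column permutations preserve this weighted sum, and removing a descent in a row increases it. It
    serves both for the termination of straightening and for triangularity on [CS mu k]. *)
Definition col_energy u := (\sum_b col_of b * u b)%N.
Definition row_energy u := (\sum_b row_of b * u b)%N.

Lemma col_energy_le u : (col_energy u <= \sum_(b : box mu) col_of b * k)%N.
Proof. by apply: leq_sum => b _; rewrite leq_mul2l (ltnW (ltn_ord _)) orbT. Qed.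

Lemma row_energy_le u : (row_energy u <= \sum_(b : box mu) row_of b * k)%N.
Proof. by apply: leq_sum => b _; rewrite leq_mul2l (ltnW (ltn_ord _)) orbT. Qed.

Lemma col_energy_col u s : s \in col_group mu -> col_energy (reindex_word u s) = col_energy u.
Proof.
move=> /col_groupP hs; rewrite [RHS]/col_energy (reindex_inj (@perm_inj _ s)) /=.
by apply: eq_bigr => b _; rewrite ffunE hs.
Qed.

Lemma row_energy_row u r : r \in row_group mu -> row_energy (reindex_word u r) = row_energy u.
Proof.
move=> /row_groupP hr; rewrite [RHS]/row_energy (reindex_inj (@perm_inj _ r)) /=.
by apply: eq_bigr => b _; rewrite ffunE hr.
Qed.

Lemma col_energy_swap u a b : (col_of a < col_of b)%N -> (u b < u a)%N ->
  (col_energy u < col_energy (reindex_word u (tperm a b)))%N.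
Proof.
move=> ab uab; rewrite /col_energy.
have ba : b != a by apply: contraTneq ab => ->; rewrite ltnn.
rewrite (bigD1 a) // (bigD1 b) //= [X in (_ < X)%N](bigD1 a) // [X in (_ < _ + X)%N](bigD1 b) //=.
rewrite !ffunE tpermL tpermR.
rewrite (eq_bigr (fun c => (col_of c * reindex_word u (tperm a b) c)%N)) => [|c /andP [ca cb]].
  rewrite !addnA ltn_add2r; move: ab uab; move: (col_of a) (col_of b) (nat_of_ord (u a)) (nat_of_ord (u b)).
  by move=> ca cb ua ub; nia.
by rewrite ffunE tpermD // eq_sym.
Qed.

(** A rearrangement inequality: a non-trivial [r] creates a descent in some row, swapping it back
    increases the energy, and iterating ends at [u]. *)
Lemma col_energy_row_lt u r : row_strict u -> r \in row_group mu -> r != 1%g ->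
  (col_energy (reindex_word u r) < col_energy u)%N.
Proof.
move=> us; have [n] := ubnP ((\sum_(b : box mu) col_of b * k) - col_energy (reindex_word u r))%N.
elim: n r => // n IH r lt_n rG r1.
have [a [b [ab ltab ltr]]] : exists a b, [/\ row_of a = row_of b, (col_of a < col_of b)%N &
    (col_of (r b) <= col_of (r a))%N].
  case: (pickP (fun ab : box mu * box mu => [&& row_of ab.1 == row_of ab.2,
     col_of ab.1 < col_of ab.2 & col_of (r ab.2) <= col_of (r ab.1)]%N)) => [[a b]|none].
    by move=> /and3P [/eqP]; exists a, b.
  case/eqP: r1; apply: row_group_sorted_eq1 => // a b ab ltab.
  by have := none (a, b); rewrite /= ab eqxx ltab /= => /negbT; rewrite -ltnNge.
have rab : (col_of (r b) < col_of (r a))%N.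
  rewrite ltn_neqAle ltr andbT; apply: contraTneq ltab => E.
  suff -> : a = b by rewrite ltnn.
  by apply/(@perm_inj _ r)/box_eq => //; rewrite !(elimT (row_groupP _) rG).
have lt1 := @col_energy_swap (reindex_word u r) a b ltab.
rewrite !ffunE reindex_wordM in lt1.
have {}lt1 := lt1 (us _ _ _ rab).
have {}lt1 := lt1 ltac:(by rewrite !(elimT (row_groupP _) rG)).
have r'G : (tperm a b * r)%g \in row_group mu by rewrite groupM ?tperm_row_group.
have le' := col_energy_le (reindex_word u (tperm a b * r)%g).
have [E|ne] := eqVneq (tperm a b * r)%g 1%g.
  by rewrite E reindex_word1 in lt1.
by apply: (ltn_trans lt1); apply: IH => //; lia.
Qed.

(** A column is determined by its multiset of entries. If [u] were smaller than [v] at [b], the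
    boxes of that column with entry below [v b] would be strictly more numerous in [u] than in
    [v]. *)
Lemma col_weak_perm_eq u v s : s \in col_group mu -> col_weak u -> col_weak v ->
  u = reindex_word v s -> u = v.
Proof.
have key u' v' s' b : s' \in col_group mu -> col_weak u' -> col_weak v' ->
    u' = reindex_word v' s' -> (u' b < v' b)%N -> False.
  move=> /col_groupP hs cu cv E ltb.
  pose Z (w : word) := [set a | (col_of a == col_of b) && (w a < v' b)%N].
  have cardZ : #|Z u'| = #|Z v'|.
    rewrite -(card_imset (Z u') (@perm_inj _ s')); congr #|pred_of_set _|.
    apply/setP => c; rewrite -[c in LHS](permKV s') (mem_imset _ _ (@perm_inj _ s')).
    by rewrite !inE E ffunE permKV -[in col_of c](permKV s' c) hs.
  suff: Z v' \proper Z u' by move=> /proper_card; rewrite cardZ ltnn.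
  apply/properP; split; last first.
    by exists b; rewrite inE eqxx ?ltb // ltnn.
  apply/subsetP => a; rewrite !inE => /andP [/eqP ab va]; rewrite ab eqxx /=.
  apply: leq_ltn_trans ltb; case: (ltngtP (row_of a) (row_of b)) => rab.
  - exact: cu.
  - by have := cv b a (esym ab) rab; rewrite leqNgt va.
  - by rewrite (box_eq rab ab).
move=> sG cu cv E; apply/ffunP => b; apply: val_inj.
case: (ltngtP (u b) (v b)) => // lt; exfalso; first exact: (key u v s b).
apply: (key v u s^-1%g b) => //; first by rewrite groupV.
by rewrite E reindex_wordM mulVg reindex_word1.
Qed.

End Tableaux.

(** * Young symmetrisers and Garnir relations *)

Section Young.
Variables (C : numFieldType) (mu : seq nat) (k : nat).
Local Notation word := {ffun box mu -> 'I_k}.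
Implicit Types (a b : box mu) (r s p : {perm box mu}) (u v : word).

(** Matrix entries of a Young symmetriser on words. The sign of [s] as weight gives Weyl's
    construction on E; the sign of [r] antisymmetrises rows and gives W on F. *)
Definition young (f : {perm box mu} -> {perm box mu} -> C) u v : C :=
  \sum_(s in col_group mu) \sum_(r in row_group mu)
    f s r * (v == reindex_word u (r * s)%g)%:R.

Definition young_rows := young (fun _ r => (-1) ^+ r).

Lemma young_rowsE v u : young_rows v u = \sum_(s in col_group mu)
  \sum_(r in row_group mu) (-1) ^+ r * (u == reindex_word v (r * s)%g)%:R.
Proof. by []. Qed.

Lemma young_rows_alt v u p : p \in row_group mu ->
  young_rows v (reindex_word u p) = (-1) ^+ p * young_rows v u.
Proof.
move=> pR; rewrite !young_rowsE mulr_sumr; apply: eq_bigr => s _.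
rewrite mulr_sumr (reindex_inj (mulgI p)) /=; apply: eq_big => r.
  by rewrite groupMl.
move=> _; rewrite odd_permM signr_addb mulrA; congr (_ * (nat_of_bool _)%:R).
by rewrite reindex_word_eqV reindex_wordM !mulgA mulVg mul1g.
Qed.

Lemma young_rows_row_eq0 v u a b : a != b -> row_of a = row_of b -> u a = u b ->
  young_rows v u = 0.
Proof.
move=> ab rab uab; apply/eqP; rewrite -eqNr; apply/eqP.
have := young_rows_alt v u (tperm_row_group rab); rewrite odd_tperm ab mulN1r => <-.
by congr young_rows; apply/ffunP => c; rewrite ffunE; case: tpermP => // ->.
Qed.

(* Conjugating by [r] turns the transposition of [a] and [b] into an element of
   the column group, so the terms cancel in pairs. *)
Lemma garnir v u (X : {set box mu}) :
  (forall r, r \in row_group mu ->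
     exists a b, [/\ a \in X, b \in X, a != b & col_of (r a) = col_of (r b)]) ->
  \sum_(p | perm_on X p) (-1) ^+ p * young_rows v (reindex_word u p) = 0.
Proof.
move=> HX; rewrite [LHS](_ : _ = \sum_(r in row_group mu) (-1) ^+ r *
  \sum_(p | perm_on X p) (-1) ^+ p *
     \sum_(s in col_group mu) (reindex_word u p == reindex_word v (r * s)%g)%:R).
  apply: big1 => r /HX [a [b [aX bX ab rab]]].
  apply/eqP; rewrite mulf_eq0; apply/orP; right.
  rewrite -eqNr -sumrN (reindex_inj (mulgI (tperm a b))) /=; apply/eqP.
  have tX : perm_on X (tperm a b).
    apply/subsetP => c; rewrite inE; apply: contraR => cX.
    by rewrite tpermD //; apply: contraNneq cX => <-.
  apply: eq_big => p.
    apply/idP/idP => h; last exact: perm_onM.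
    by rewrite -[p](mulKg (tperm a b)) tpermV; apply: perm_onM.
  move=> _; rewrite odd_permM odd_tperm ab signr_addb expr1 mulN1r mulNr opprK.
  congr (_ * _); rewrite (reindex_inj (mulgI (tperm (r a) (r b)))) /=.
  apply: eq_big => s; first by rewrite groupMl ?tperm_col_group.
  move=> _; congr (nat_of_bool _)%:R.
  rewrite -(reindex_wordM u p (tperm a b)) reindex_word_eqV reindex_wordM tpermV.
  by rewrite -tpermJ /conjg !mulgA mulgK tperm2 mul1g.
under eq_bigr => p _ do rewrite young_rowsE mulr_sumr.
under [RHS]eq_bigr => r _ do rewrite mulr_sumr.
rewrite [RHS]exchange_big /=; apply: eq_bigr => p _.
under eq_bigr => s _ do rewrite mulr_sumr.
rewrite exchange_big /=; apply: eq_bigr => r _; rewrite !mulr_sumr.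
by apply: eq_bigr => s _; rewrite mulrCA.
Qed.

Hypothesis mu_sorted : sorted geq mu.

Lemma row_length_geq i j : (i <= j)%N -> (nth 0%N mu j <= nth 0%N mu i)%N.
Proof.
move=> ij; have [lt_j|ge_j] := ltnP j (size mu); last by rewrite [X in (X <= _)%N]nth_default.
have geq_trans : transitive geq by move=> y x z /= yx zy; apply: leq_trans zy yx.
by apply: (sorted_leq_nth geq_trans) => //; [exact: leqnn|exact: leq_ltn_trans lt_j].
Qed.

(** Either the box just below [a] already gives a descent, or its entry is at least that of [a] and
    it can replace [a]. *)
Lemma adjacent_descent u a b : col_of a = col_of b -> (row_of a < row_of b)%N ->
  (u b < u a)%N ->
  exists a' b' : box mu, [/\ col_of a' = col_of b', row_of b' = (row_of a').+1 & (u b' < u a')%N].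
Proof.
have [n] := ubnP (row_of b - row_of a)%N; elim: n a => // n IH a lt_n cab rab uab.
have [c [rc cc]] : exists c : box mu, row_of c = (row_of a).+1 /\ col_of c = col_of a.
  apply: box_exists; rewrite cab; apply: leq_trans (col_of_lt b) _.
  exact: row_length_geq.
have [lt_c|ge_c] := ltnP (u c) (u a); first by exists a, c; rewrite cc.
apply: (IH c); rewrite ?rc ?cc //; first by lia.
  rewrite ltn_neqAle rab andbT; apply: contraTneq uab => E.
  by rewrite -leqNgt (_ : b = c) //; apply: box_eq; rewrite ?cc // rc E.
exact: leq_trans uab ge_c.
Qed.

Section Descent.
Variables (u : word) (a0 b0 : box mu).
Hypotheses (us : row_strict u) (c_ab : col_of a0 = col_of b0)
  (r_ab : row_of b0 = (row_of a0).+1) (desc : (u b0 < u a0)%N).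

Definition garnir_set := [set b : box mu |
   (row_of b == row_of a0) && (col_of a0 <= col_of b)%N
   || (row_of b == row_of b0) && (col_of b <= col_of b0)%N].

(** Pigeonhole: [garnir_set] has one box more than the row of [a0] has columns, and [r] keeps its
    boxes in two rows that are no longer than that. *)
Lemma garnir_set_collision r : r \in row_group mu ->
  exists a b, [/\ a \in garnir_set, b \in garnir_set, a != b & col_of (r a) = col_of (r b)].
Proof.
clear us desc; move=> /row_groupP rR; set l := nth 0%N mu (row_of a0); set j := col_of a0.
have lt_j : (j < l)%N := col_of_lt a0.
(* An enumeration of [garnir_set]: columns 0 to [j] of the lower row, then columns [j] to [l - 1] of
   the upper row. Column [j] occurs in both, hence the shift by one. *)
have hg (x : 'I_l.+1) : exists b : box mu,
    (if x <= j then row_of b = row_of b0 /\ col_of b = x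
     else row_of b = row_of a0 /\ col_of b = x.-1)%N.
  have [xj|xj] := leqP x j; apply: box_exists; last by have := ltn_ord x; rewrite -/l; lia.
  by apply: leq_ltn_trans xj _; rewrite /j c_ab col_of_lt.
have [g gP] := fin_all_exists hg.
have gX x : g x \in garnir_set.
  have := gP x; rewrite inE; case: ifP => [xj [-> ->]|/negbT xj [-> ->]]; rewrite eqxx -?c_ab.
    by rewrite xj orbT.
  by rewrite /= -/j; apply/orP; left; lia.
have g_inj : injective g.
  move=> x y E; apply: val_inj; have := gP x; have := gP y; rewrite E /=.
  by case: ifP => yj [ry cy]; case: ifP => xj [rx cx]; move: r_ab; lia.
have lt_l x : (col_of (r (g x)) < l)%N.
  apply: leq_trans (col_of_lt _) _; rewrite rR; have := gX x; rewrite inE.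
  by case/orP => /andP [/eqP ->] // _; apply: row_length_geq; rewrite r_ab.
have /injectivePn [x [y xy E]] : ~~ injectiveb (fun x => Ordinal (lt_l x)).
  by apply/negP => /injectiveP /leq_card; rewrite !card_ord ltnn.
exists (g x), (g y); split => //; first by rewrite (inj_eq g_inj).
by case: E.
Qed.

(** Row strictness and the descent make every entry of the upper part of [garnir_set] larger than
    every entry of the lower part, so an exchange between the rows moves larger entries down. *)
Lemma garnir_set_energy p : perm_on garnir_set p -> p \notin row_group mu ->
  (row_energy u < row_energy (reindex_word u p))%N.
Proof.
clear mu_sorted; move=> pX pR; have pVX : perm_on garnir_set p^-1%g by apply: perm_onV.
pose D b := (row_of (p^-1%g b))%:Z - (row_of b)%:Z.
(* Twice the distance of the entry from the half-integer just below [u a0]: positive on the upper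
   part, negative on the lower. It therefore has the sign of the displacement [D b] whenever the row
   changes; the constant drops out as the displacements sum to 0. *)
pose F b := 2%:Z * (u b)%:Z - 2%:Z * (u a0)%:Z + 1.
have DF b : 0 <= D b * F b /\ (row_of (p^-1%g b) != row_of b -> 0 < D b * F b).
  rewrite /D; have [bX|bX] := boolP (b \in garnir_set); last first.
    by rewrite (out_perm pVX) // eqxx subrr mul0r.
  have := bX; have : (p^-1)%g b \in garnir_set by rewrite (perm_closed _ pVX).
  rewrite !inE.
  have ub : row_of b = row_of a0 -> (col_of a0 <= col_of b)%N -> (u a0 <= u b)%N.
    rewrite leq_eqVlt => rb /orP [/eqP E|/us/ltnW]; last by apply.
    by rewrite (@box_eq _ b a0).
  have ub' : row_of b = row_of b0 -> (col_of b <= col_of b0)%N -> (u b <= u b0)%N.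
    rewrite leq_eqVlt => rb /orP [/eqP E|/us/ltnW]; last by apply.
    by rewrite (@box_eq _ b b0).
  rewrite /F; move: ub ub' desc r_ab.
  move: (row_of (p^-1%g b)) (row_of b) (row_of a0) (row_of b0) => r1 r2 r3 r4.
  move: (nat_of_ord (u a0)) (nat_of_ord (u b)) (nat_of_ord (u b0)) => x y z.
  move=> ub ub' desc' er; subst r4.
  case/orP => /andP [/eqP -> _]; case/orP => /andP [/eqP E lec].
  - by rewrite E subrr mul0r eqxx.
  - have := ub' E lec; rewrite E => uz; split; nia.
  - have := ub E lec; rewrite E => uz; split; nia.
  - by rewrite E subrr mul0r eqxx.
have [b0' ne] : exists b, row_of (p^-1%g b) != row_of b.
  apply/existsP; rewrite -negb_forall; apply: contra pR => /forallP h.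
  by rewrite -groupV; apply/row_groupP => b; apply/eqP.
have pos : 0 < \sum_b D b * F b.
  rewrite (bigD1 b0') //= ltr_wpDr ?(DF b0').2 // sumr_ge0 // => b _.
  by case: (DF b).
have sumD : \sum_b D b = 0.
  rewrite /D sumrB (reindex_inj (@perm_inj _ p)) /=.
  by under eq_bigr => b _ do rewrite permK; rewrite subrr.
have : \sum_b D b * F b = 2%:Z * ((row_energy (reindex_word u p))%:Z - (row_energy u)%:Z).
  transitivity (\sum_b (2%:Z * (D b * (u b)%:Z) + D b * (1 - 2%:Z * (u a0)%:Z))).
    by apply: eq_bigr => b _; rewrite /F; ring.
  rewrite big_split /= -mulr_suml sumD mul0r addr0 -mulr_sumr; congr (_ * _).
  under eq_bigr => b _ do rewrite mulrBl.
  rewrite sumrB (reindex_inj (@perm_inj _ p)) /=.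
  have posz_sum (f : box mu -> nat) : (\sum_b f b)%N%:Z = \sum_b (f b)%:Z.
    exact: (big_morph Posz PoszD).
  rewrite /row_energy !posz_sum; congr (_ - _).
    by apply: eq_bigr => b _; rewrite permK ffunE PoszM.
move=> E; move: pos; rewrite E pmulr_rgt0 // subr_gt0.
by rewrite ltz_nat.
Qed.
End Descent.
End Young.

Section Straightening.
Variables (C : numFieldType) (mu : seq nat) (k : nat).
Hypothesis mu_sorted : sorted geq mu.
Local Notation word := {ffun box mu -> 'I_k}.
Local Notation young_rows := (@young_rows C mu k).
Implicit Types (a b : box mu) (r s p : {perm box mu}) (u v : word).

(** [K] exceeds every column energy, so [energy] is the lexicographic order with row energy
    first. *)
Let K := (\sum_(b : box mu) col_of b * k).+1.
Let energy u := (row_energy u * K + col_energy u)%N.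
Let energy_max := ((\sum_(b : box mu) row_of b * k) * K + K)%N.

Let energy_le u : (energy u <= energy_max)%N.
Proof.
rewrite /energy /energy_max leq_add // ?leq_mul2r ?row_energy_le ?orbT //.
by rewrite ltnW // ltnS col_energy_le.
Qed.

Let energy_row u v : (row_energy u < row_energy v)%N -> (energy u < energy v)%N.
Proof.
move=> lt; rewrite /energy; have := col_energy_le u; rewrite -ltnS -/K => ltK.
apply: leq_trans (leq_addr _ _); rewrite -addnS addnC.
by apply: leq_trans (leq_mul lt (leqnn K)); rewrite mulSn leq_add2r.
Qed.

(** Each rewriting step raises the bounded [energy]: a row descent is swapped at the cost of a sign,
    a column descent is removed by a Garnir relation. The coefficients do not depend on [v], so this
    is a relation between columns of [young_rows]. *)
Lemma straightening u : exists c : word -> C, forall v,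
  young_rows v u = \sum_(w in CS mu k) c w * young_rows v w.
Proof.
have [n] := ubnP (energy_max - energy u)%N; elim: n u => // n IH u lt_n.
have [uCS|uCS] := boolP (u \in CS mu k).
  exists (fun w => (w == u)%:R) => v; rewrite (bigD1 u) //= eqxx mul1r big1 ?addr0 //.
  by move=> w /andP [_ /negPf ->]; rewrite mul0r.
have IHlt w : (energy u < energy w)%N -> exists c : word -> C, forall v,
    young_rows v w = \sum_(w in CS mu k) c w * young_rows v w.
  by move=> lt; apply: IH; have := energy_le w; lia.
have [/existsP [a /existsP [b /and3P [/eqP rab cab uab]]]|strict] := boolP
   [exists a, exists b, [&& row_of a == row_of b, col_of a < col_of b & u b <= u a]%N].
  have ab : a != b by apply: contraTneq cab => ->; rewrite ltnn.
  move: uab; rewrite leq_eqVlt => /orP [/eqP/val_inj uab|uab].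
    exists (fun=> 0) => v; rewrite (young_rows_row_eq0 C v ab) // big1 // => w _.
    by rewrite mul0r.
  have [|c cP] := IHlt (reindex_word u (tperm a b)).
    by rewrite /energy row_energy_row ?tperm_row_group // ltn_add2l col_energy_swap.
  exists (fun w => - c w) => v; rewrite (eq_bigr _ (fun _ _ => mulNr _ _)) sumrN -cP.
  by rewrite young_rows_alt ?tperm_row_group // odd_tperm ab mulN1r opprK.
have us : row_strict u.
  move=> a b rab cab; rewrite ltnNge; apply: contra strict => uab.
  by apply/existsP; exists a; apply/existsP; exists b; rewrite rab eqxx cab uab.
have [a [b [cab rab uab]]] : exists a b : box mu,
    [/\ col_of a = col_of b, row_of b = (row_of a).+1 & (u b < u a)%N].
  case: (pickP (fun ab : box mu * box mu => [&& col_of ab.1 == col_of ab.2,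
     row_of ab.1 < row_of ab.2 & u ab.2 < u ab.1]%N)) => [[a b] /and3P [/eqP]|none].
    exact: adjacent_descent.
  case/CSP: uCS; split=> // a b cab rab; rewrite leqNgt.
  by have := none (a, b); rewrite /= cab eqxx rab => /negbT.
pose X := garnir_set a b.
have /fin_all_exists [c cP] : forall p, exists c : word -> C,
    perm_on X p -> p \notin row_group mu -> forall v,
    young_rows v (reindex_word u p) = \sum_(w in CS mu k) c w * young_rows v w.
  move=> p; have [/andP [pX pR]|] := boolP (perm_on X p && (p \notin row_group mu)).
    have [|c cP] := IHlt (reindex_word u p); last by exists c.
    by apply: energy_row; apply: (garnir_set_energy us cab rab uab pX pR).
  by rewrite negb_and => h; exists (fun=> 0) => pX pR; rewrite pX pR in h.
(* In the Garnir relation, each [p] in the row group contributes [young_rows v u] itself, its two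
   signs cancelling. There are [N] such terms, at least one, so the relation can be solved for it in
   characteristic zero. *)
pose N := #|[pred p | perm_on X p && (p \in row_group mu)]|.
have N_neq0 : N%:R != 0 :> C.
  rewrite pnatr_eq0 -lt0n; apply/card_gt0P; exists 1%g.
  by rewrite inE perm_on1 group1.
pose S w := \sum_(p | perm_on X p && (p \notin row_group mu)) (-1) ^+ p * c p w.
exists (fun w => - (N%:R^-1 * S w)) => v.
have := garnir C v u (garnir_set_collision mu_sorted cab rab).
rewrite -/X (bigID (mem (row_group mu))) /=.
rewrite (eq_bigr (fun=> young_rows v u)) => [|p /andP [_ pR]]; last first.
  by rewrite young_rows_alt // mulrA -expr2 sqrr_sign mul1r.
rewrite sumr_const -[#|_|]/N => /eqP; rewrite addr_eq0 => /eqP E.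
apply: (mulfI N_neq0); rewrite mulr_natl E mulr_sumr -sumrN.
transitivity (\sum_(w in CS mu k) - (S w * young_rows v w)); last first.
  by apply: eq_bigr => w _; rewrite mulrA mulrN mulrA divff // mul1r mulNr.
rewrite !sumrN; congr (- _); under [RHS]eq_bigr => w _ do rewrite mulr_suml.
rewrite [RHS]exchange_big /=; apply: eq_bigr => p /andP [pX pR].
by rewrite cP // mulr_sumr; apply: eq_bigr => w _; rewrite mulrA.
Qed.

(** A non-zero entry makes a column rearrangement of [v] equal to a row rearrangement of [u]. The
    former keeps the column energy; the latter lowers it unless trivial. *)
Lemma young_rows_triangular u v : row_strict u -> col_weak u -> col_weak v ->
  young_rows v u != 0 -> (col_energy v < col_energy u)%N \/ v = u.
Proof.
move=> us uw vw; have [/existsP [s /existsP [r /and3P [sC rR /eqP E]]] _|none] := boolP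
  [exists s, exists r, [&& s \in col_group mu, r \in row_group mu & u == reindex_word v (r * s)%g]].
  have {}E : reindex_word v s = reindex_word u r^-1%g.
    by rewrite E reindex_wordM mulgA mulVg mul1g.
  have [r1|r1] := eqVneq r 1%g.
    right; symmetry; apply: (col_weak_perm_eq sC) => //.
    by rewrite E r1 invg1 reindex_word1.
  left; rewrite -(col_energy_col v sC) E; apply: col_energy_row_lt; rewrite ?groupV //.
  by rewrite eq_invg1.
case/eqP; rewrite young_rowsE big1 // => s sC; rewrite big1 // => r rR.
have := none; rewrite negb_exists => /forallP/(_ s); rewrite negb_exists => /forallP/(_ r).
by rewrite sC rR /= => /negPf ->; rewrite mulr0.
Qed.

(** By the energy argument only [r = 1] contributes, so the entry counts, without signs, the column
    permutations fixing [u]. *)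
Lemma young_rows_diag u : row_strict u -> young_rows u u != 0.
Proof.
move=> us; rewrite young_rowsE.
rewrite (eq_bigr (fun s => (u == reindex_word u s)%:R)) => [|s sC].
  rewrite -natr_sum pnatr_eq0 (bigD1 1%g) ?group1 //= reindex_word1 eqxx.
  by rewrite addn_eq0.
rewrite (bigD1 1%g) ?group1 //= odd_perm1 !mul1g mul1r big1 ?addr0 // => r /andP [rR r1].
case: eqP => [E|]; last by rewrite mulr0.
have E' : reindex_word u s = reindex_word u r^-1%g.
  by rewrite {2}E reindex_wordM mulgA mulVg mul1g.
have := col_energy_row_lt us (groupVr rR); rewrite eq_invg1 r1 => /(_ isT).
by rewrite -E' col_energy_col // ltnn.
Qed.

Definition CS_word (i : 'I_#|CS mu k|) : word := enum_val i.

Definition CS_gram : 'M[C]_#|CS mu k| := \matrix_(i, j) young_rows (CS_word i) (CS_word j).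

Lemma CS_gram_unit : CS_gram \in unitmx.
Proof.
rewrite -row_free_unit; apply: inj_row_free => x xG.
apply/eqP; case: (pickP (fun i => x 0 i != 0)) => [i0 xi0|x0]; last first.
  by apply/eqP/rowP => i; rewrite mxE; have /negbT := x0 i; rewrite negbK => /eqP.
(* At a support index of least column energy, triangularity leaves only the diagonal term of the
   relation. *)
case: (@arg_minnP _ i0 (fun i => x 0 i != 0) (fun i => col_energy (CS_word i)) xi0) => i xi min_i.
have /CSP [us uw] : CS_word i \in CS mu k := enum_valP i.
have /rowP/(_ i) := xG; rewrite !mxE (bigD1 i) //= big1 => [|j ji].
  rewrite addr0 mxE => /eqP; rewrite mulf_eq0 (negPf xi) (negPf (young_rows_diag us)).
  by [].
have [->|xj] := eqVneq (x 0 j) 0; first by rewrite mul0r.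
have /CSP [vs vw] : CS_word j \in CS mu k := enum_valP j.
rewrite mxE; have [->|/(young_rows_triangular us uw vw)] := eqVneq (young_rows (CS_word j) (CS_word i)) 0.
  by rewrite mulr0.
case=> [lt|/enum_val_inj E]; last by rewrite E eqxx in ji.
by have := min_i j xj; rewrite leqNgt lt.
Qed.

(* Straightening bounds the column rank of [young_rows] and [CS_gram] is an
   invertible minor of that size, so the corresponding rows span. *)
Lemma young_rows_span v : exists c : 'I_#|CS mu k| -> C, forall u,
  young_rows v u = \sum_i c i * young_rows (CS_word i) u.
Proof.
pose y := \row_j young_rows v (CS_word j).
exists (fun i => (y *m invmx CS_gram) 0 i) => u.
have [c cP] := straightening u; pose cc := \col_j c (CS_word j).
have E w : young_rows w u = ((\row_j young_rows w (CS_word j)) *m cc) 0 0.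
  rewrite cP mxE big_enum_val.
  by apply: eq_bigr => j _; rewrite !mxE mulrC.
transitivity ((y *m invmx CS_gram *m (CS_gram *m cc)) 0 0).
  by rewrite E mulmxA mulmxKV // CS_gram_unit.
rewrite [LHS]mxE; apply: eq_bigr => i _; congr (_ * _).
by rewrite E !mxE; apply: eq_bigr => j _; rewrite !mxE.
Qed.
End Straightening.

(** * Tensor powers of Young symmetrisers *)

Section PermKernel.
Variables (C : comNzRingType) (Q I : finType) (phi : I -> C) (p : I -> {perm Q}).

(** The matrix of a group algebra element acting by place permutations, over an arbitrary alphabet,
    so that the same element acts on words of E and of F. *)
Definition perm_kernel (T : finType) (u t : {ffun Q -> T}) : C :=
  \sum_i phi i * (t == reindex_word u (p i))%:R.

Lemma sum_perm_kernel (T : finType) (F : {ffun Q -> T} -> C) u :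
  \sum_t perm_kernel u t * F t = \sum_i phi i * F (reindex_word u (p i)).
Proof.
under eq_bigr => t _ do rewrite /perm_kernel mulr_suml.
rewrite exchange_big /=; apply: eq_bigr => i _.
rewrite (bigD1 (reindex_word u (p i))) //= eqxx mulr1 big1 ?addr0 // => t /negPf ->.
by rewrite mulr0 mul0r.
Qed.

Lemma sum_perm_kernel_r (T : finType) (F : {ffun Q -> T} -> C) t :
  \sum_u F u * perm_kernel u t = \sum_i phi i * F (reindex_word t (p i)^-1%g).
Proof.
under eq_bigr => u _ do rewrite /perm_kernel mulr_sumr.
rewrite exchange_big /=; apply: eq_bigr => i _.
rewrite (bigD1 (reindex_word t (p i)^-1%g)) //= reindex_wordM mulgV reindex_word1 eqxx.
rewrite mulr1 mulrC big1 ?addr0 // => u /negPf ne.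
by rewrite eq_sym reindex_word_eqV ne !mulr0.
Qed.

Lemma tact_perm_kernel (d : nat) (g : 'M[C]_d) (u t : {ffun Q -> 'I_d}) :
  tact g (perm_kernel u) t = \sum_(v : {ffun Q -> 'I_d}) (\prod_q g (u q) (v q)) * perm_kernel v t.
Proof.
rewrite /tact sum_perm_kernel sum_perm_kernel_r; apply: eq_bigr => i _; congr (_ * _).
rewrite [RHS](reindex_inj (@perm_inj _ (p i))) /=.
by apply: eq_bigr => q _; rewrite !ffunE permK.
Qed.

End PermKernel.

(** Moving a place permutation across the pairing costs its sign. This is how antisymmetrised
    columns become antisymmetrised rows. *)
Lemma perm_kernel_intertwine (C : comNzRingType) (Q I S T : finType) (phi psi : I -> C)
    (p : I -> {perm Q}) (P : {ffun Q -> S} -> {ffun Q -> T} -> C) :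
  (forall r s a, P (reindex_word s r) (reindex_word a r) = (-1) ^+ r * P s a) ->
  (forall i, psi i = phi i * (-1) ^+ p i) ->
  forall u a, \sum_t perm_kernel phi p u t * P t a = \sum_b P u b * perm_kernel psi p b a.
Proof.
move=> Psign psiE u a; rewrite sum_perm_kernel sum_perm_kernel_r.
apply: eq_bigr => i _; rewrite psiE -mulrA -Psign; congr (_ * P _ _).
by rewrite reindex_wordM mulgV reindex_word1.
Qed.

Section TensorPower.
Variables (C : comNzRingType) (N B : finType).

Definition slot (T : finType) (t : {ffun N * B -> T}) (nu : N) : {ffun B -> T} :=
  [ffun b => t (nu, b)].

Definition join (T : finType) (w : N -> {ffun B -> T}) : {ffun N * B -> T} :=
  [ffun q => w q.1 q.2].

Lemma slot_join (T : finType) (w : N -> {ffun B -> T}) nu : slot (join w) nu = w nu.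
Proof. by apply/ffunP => b; rewrite !ffunE. Qed.

Lemma slot_inj (T : finType) (t u : {ffun N * B -> T}) : slot t =1 slot u -> t = u.
Proof. by move=> E; apply/ffunP => -[nu b]; have /ffunP/(_ b) := E nu; rewrite !ffunE. Qed.

Lemma slot_left_perm (T : finType) (t : {ffun N * B -> T}) p nu :
  slot (reindex_word t (left_perm B p)) nu = slot t (p nu).
Proof. by apply/ffunP => b; rewrite !ffunE left_permE. Qed.

Lemma prod_sum_slots (T : finType) (F : N -> {ffun B -> T} -> C) :
  \prod_nu \sum_u F nu u = \sum_t \prod_nu F nu (slot t nu).
Proof.
rewrite (bigA_distr_bigA F) /=.
rewrite [RHS](reindex (fun w : {ffun N -> {ffun B -> T}} => join w)) /=.
  by apply: eq_bigr => w _; apply: eq_bigr => nu _; rewrite slot_join.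
exists (fun t => [ffun nu => slot t nu]) => t _.
  by apply/ffunP => nu; rewrite ffunE slot_join.
by apply: slot_inj => nu; rewrite slot_join ffunE.
Qed.

Definition tensor_power (T : finType) (A : {ffun B -> T} -> {ffun B -> T} -> C)
  (u t : {ffun N * B -> T}) : C := \prod_nu A (slot u nu) (slot t nu).

Lemma tensor_power_perm_kernel (I : finType) (phi : I -> C) (p : I -> {perm B}) (T : finType)
    (u t : {ffun N * B -> T}) :
  tensor_power (@perm_kernel C B I phi p T) u t =
  perm_kernel (fun i : {ffun N -> I} => \prod_nu phi (i nu))
              (fun i => block_perm (fun nu => p (i nu))) u t.
Proof.
rewrite /tensor_power /perm_kernel.
rewrite (bigA_distr_bigA (fun nu i => phi i * (slot t nu == reindex_word (slot u nu) (p i))%:R)).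
apply: eq_bigr => i _; rewrite big_split /=; congr (_ * _).
have sl nu : slot (reindex_word u (block_perm (fun nu => p (i nu)))) nu
    = reindex_word (slot u nu) (p (i nu)).
  by apply/ffunP => b; rewrite !ffunE block_permE.
case: eqP => [->|/eqP ne]; first by rewrite big1 // => nu _; rewrite sl eqxx.
have [/forallP h|] := boolP [forall nu, slot t nu == reindex_word (slot u nu) (p (i nu))].
  by case/eqP: ne; apply: slot_inj => nu; rewrite sl (eqP (h nu)).
by rewrite negb_forall => /existsP [nu /negPf ne']; rewrite (bigD1 nu) //= ne' mul0r.
Qed.

End TensorPower.

Section YoungPower.
Variables (C : numFieldType) (N : finType) (mu : seq nat).
Local Notation B := (box mu).
Let J : finType := ({perm B} * {perm B})%type.

(** Extension by zero to all pairs, so that tensor powers are sums over a full function type. *)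
Definition young_coef (f : {perm B} -> {perm B} -> C) (i : J) : C :=
  if (i.1 \in col_group mu) && (i.2 \in row_group mu) then f i.1 i.2 else 0.

Lemma young_perm_kernel k f (u t : {ffun B -> 'I_k}) :
  young f u t = perm_kernel (young_coef f) (fun i : J => (i.2 * i.1)%g) u t.
Proof.
rewrite /young pair_big_dep /= big_mkcond /=; apply: eq_bigr => -[s r] _ /=.
by rewrite /young_coef /=; case: ifP => // _; rewrite mul0r.
Qed.

Lemma tensor_power_young k f (u t : {ffun N * B -> 'I_k}) :
  tensor_power (young f) u t =
  perm_kernel (fun i : {ffun N -> J} => \prod_nu young_coef f (i nu))
    (fun i => block_perm (fun nu => (i nu).2 * (i nu).1)%g) u t.
Proof.
rewrite -(tensor_power_perm_kernel (young_coef f) (fun i : J => i.2 * i.1)%g).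
by apply: eq_bigr => nu _; rewrite young_perm_kernel.
Qed.

Definition in_young_power k f (x : {ffun N * B -> 'I_k} -> C) :=
  exists c : {ffun N * B -> 'I_k} -> C, forall t, x t = \sum_u c u * tensor_power (young f) u t.

Lemma in_young_power_tact k f (g : 'M[C]_k) x :
  in_young_power f x -> in_young_power f (tact g x).
Proof.
case=> c xE; exists (fun v => \sum_u c u * \prod_q g (u q) (v q)) => t.
rewrite (eq_tact _ xE) /tact.
under eq_bigr => s _ do rewrite mulr_suml.
under [RHS]eq_bigr => v _ do rewrite mulr_suml.
rewrite exchange_big [RHS]exchange_big /=; apply: eq_bigr => u _.
have E : tact g (tensor_power (young f) u) t =
    \sum_(v : {ffun N * B -> 'I_k}) (\prod_q g (u q) (v q)) * tensor_power (young f) v t.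
  rewrite (eq_tact _ (fun v => tensor_power_young f u v)) tact_perm_kernel.
  by apply: eq_bigr => v _; rewrite tensor_power_young.
transitivity (c u * tact g (tensor_power (young f) u) t).
  by rewrite /tact mulr_sumr; apply: eq_bigr => v _; rewrite mulrA.
by rewrite E mulr_sumr; apply: eq_bigr => v _; rewrite mulrA.
Qed.

Lemma in_young_power_pairing d k (f h : {perm B} -> {perm B} -> C)
    (P : {ffun N * B -> 'I_d} -> {ffun N * B -> 'I_k} -> C) x :
  (forall r s a, P (reindex_word s r) (reindex_word a r) = (-1) ^+ r * P s a) ->
  (forall s r, h s r = f s r * (-1) ^+ (r * s)%g) ->
  in_young_power f x -> in_young_power h (fun a => \sum_t P t a * x t).
Proof.
move=> Psign hf [c xE]; exists (fun b => \sum_u c u * P u b) => a.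
under eq_bigr => t _ do rewrite xE mulr_sumr.
under [RHS]eq_bigr => b _ do rewrite mulr_suml.
rewrite exchange_big [RHS]exchange_big /=; apply: eq_bigr => u _.
under eq_bigr => t _ do rewrite mulrCA [P _ _ * _]mulrC.
under [RHS]eq_bigr => b _ do rewrite -mulrA.
rewrite -!mulr_sumr; congr (_ * _).
under eq_bigr => t _ do rewrite tensor_power_young.
under [RHS]eq_bigr => b _ do rewrite tensor_power_young.
apply: perm_kernel_intertwine => // i; rewrite odd_block_perm -big_split /=.
apply: eq_bigr => nu _; rewrite /young_coef; case: ifP => _; last by rewrite mul0r.
by rewrite hf.
Qed.

End YoungPower.

Lemma card_box (mu : seq nat) : #|box mu| = sumn mu.
Proof.
rewrite card_tagged sumnE big_map big_enum /=.
under eq_bigr => i _ do rewrite card_ord.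
by rewrite [RHS]sumnE (big_nth 0%N) big_mkord.
Qed.

(** * The top exterior power of W *)

Section Alternating.
Variables (C : numFieldType) (mu : seq nat) (k : nat).
Hypothesis mu_sorted : sorted geq mu.
Local Notation n := #|CS mu k|.
Local Notation word := {ffun 'I_n * box mu -> 'I_k}.
Local Notation young_rows := (@young_rows C mu k).
Local Notation CS_word := (@CS_word mu k).

Definition alternating (y : word -> C) :=
  forall (p : {perm 'I_n}) a, y (reindex_word a (left_perm (box mu) p)) = (-1) ^+ p * y a.

Definition CS_wedge (a : word) : C :=
  \det (\matrix_(i, j < n) young_rows (CS_word i) (slot a j)).

Lemma CS_wedge_alternating : alternating CS_wedge.
Proof.
move=> p a; rewrite /CS_wedge.
rewrite -odd_permV -det_perm mulrC -det_mulmx -col_permE; congr (\det _).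
by apply/matrixP => i j; rewrite !mxE slot_left_perm.
Qed.

Lemma CS_wedge_neq0 : CS_wedge (join CS_word) != 0.
Proof.
rewrite -unitfE -unitmxE; have := CS_gram_unit C mu k; rewrite (_ : CS_gram _ _ _ = \matrix_(i, j) young_rows (CS_word i) (slot (join CS_word) j)) //.
by apply/matrixP => i j; rewrite !mxE slot_join.
Qed.

Lemma CS_wedge_in : in_young_power (fun _ r => (-1) ^+ r) CS_wedge.
Proof.
exists (fun u => \sum_(p : {perm 'I_n}) (-1) ^+ p * (u == join (fun i => CS_word (p i)))%:R) => a.
rewrite /CS_wedge -det_tr /determinant.
under [RHS]eq_bigr => u _ do rewrite mulr_suml.
rewrite exchange_big /=; apply: eq_bigr => p _.
rewrite (bigD1 (join (fun i => CS_word (p i)))) //= eqxx mulr1 [X in _ + X]big1.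
  rewrite addr0; congr (_ * _); apply: eq_bigr => i _.
  by rewrite !mxE slot_join.
by move=> u /negPf ->; rewrite mulr0 mul0r.
Qed.

(** Expand [y] over n-tuples [l] of the n basis vectors of W. Antisymmetrising the term of [l] gives
    [D l] times [CS_wedge], with [D l] the sign of [l], or 0 if [l] is not a bijection. *)
Lemma alternating_unique y : alternating y -> in_young_power (fun _ r => (-1) ^+ r) y ->
  exists lambda, forall a, y a = lambda * CS_wedge a.
Proof.
move=> alt [c yE].
have [e eP] := fin_all_exists (young_rows_span C mu_sorted (k := k)).
pose D (l : {ffun 'I_n -> 'I_n}) : C := \det (rowsub l 1%:M).
pose c' (l : {ffun 'I_n -> 'I_n}) := \sum_u c u * \prod_nu e (slot u nu) (l nu).
have yE' a : y a = \sum_l c' l * \prod_nu young_rows (CS_word (l nu)) (slot a nu).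
  rewrite yE; under [RHS]eq_bigr => l _ do rewrite mulr_suml.
  rewrite exchange_big /=; apply: eq_bigr => u _.
  under [RHS]eq_bigr => l _ do rewrite -mulrA -big_split /=.
  rewrite -mulr_sumr; congr (_ * _).
  rewrite -(bigA_distr_bigA (fun nu i => e (slot u nu) i * young_rows (CS_word i) (slot a nu))).
  by apply: eq_bigr => nu _; exact: eP.
exists ((n`!)%:R^-1 * \sum_l c' l * D l) => a.
have fact_neq0 : (n`!)%:R != 0 :> C by rewrite pnatr_eq0 -lt0n fact_gt0.
apply: (mulfI fact_neq0); rewrite -mulrA mulVKf // mulr_suml.
(* As [y] is alternating, antisymmetrising it multiplies it by n!. *)
transitivity (\sum_(p : {perm 'I_n}) (-1) ^+ p * y (reindex_word a (left_perm (box mu) p))).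
  under eq_bigr => p _ do rewrite alt mulrA -expr2 sqrr_sign mul1r.
  by rewrite sumr_const card_Sn mulr_natl.
under eq_bigr => p _ do rewrite yE' mulr_sumr.
rewrite exchange_big /=; apply: eq_bigr => l _.
rewrite -mulrA -det_mulmx /determinant mulr_sumr; apply: eq_bigr => p _.
rewrite mulrCA; congr (_ * (_ * _)); apply: eq_bigr => i _.
rewrite slot_left_perm mxE (bigD1 (l i)) //= !mxE eqxx mul1r big1 ?addr0 // => j /negPf ne.
by rewrite !mxE eq_sym ne mul0r.
Qed.

Lemma alternating_tact g y : alternating y -> alternating (tact g y).
Proof.
move=> alt p a; rewrite /tact mulr_sumr.
rewrite (reindex_inj (bij_inj (reindex_word_bij _ (left_perm (box mu) p)))) /=.
apply: eq_bigr => s _; rewrite alt -mulrA; congr (_ * (_ * _)).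
rewrite [RHS](reindex_inj (@perm_inj _ (left_perm (box mu) p))) /=.
by apply: eq_bigr => q _; rewrite !ffunE.
Qed.

(** The action preserves both conditions of [alternating_unique], hence the line; the scalar is read
    off where [CS_wedge] is known not to vanish. *)
Lemma CS_wedge_eigen : exists delta : 'M[C]_k -> C, forall g a,
  tact g CS_wedge a = delta g * CS_wedge a.
Proof.
exists (fun g => tact g CS_wedge (join CS_word) / CS_wedge (join CS_word)) => g a.
have [lambda lP] := alternating_unique
  (alternating_tact g CS_wedge_alternating) (in_young_power_tact g CS_wedge_in).
by rewrite !lP mulfK // CS_wedge_neq0.
Qed.
End Alternating.

(** * Transfer of semi-invariants between GL(E) and GL(F) *)

Section Invariants.
Variables (C : numClosedFieldType) (mu : seq nat) (k d : nat).
Hypotheses (mu_sorted : sorted geq mu) (mu_odd : odd (sumn mu)).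
Local Notation n := #|CS mu k|.
Hypotheses (n_gt0 : (0 < n)%N) (dk : (d * k = sumn mu * n)%N).
Local Notation Q := ('I_n * box mu)%type.

Definition tensor_invariant (x : {ffun Q -> 'I_d} -> C) :=
  [/\ in_young_power (fun s _ => (-1) ^+ s) x,
      forall (p : {perm 'I_n}) t, x (reindex_word t (left_perm (box mu) p)) = x t
    & forall g, g \in unitmx -> forall t, tact g x t = \det g ^+ k * x t].

Lemma tensor_invariant_unique : exists x, [/\ tensor_invariant x, exists t, x t != 0 &
  forall x', tensor_invariant x' -> exists lambda, forall t, x' t = lambda * x t].
Proof.
have dk_gt0 : (0 < d * k)%N by rewrite dk muln_gt0 n_gt0 odd_gt0.
have [d_gt0 k_gt0] : (0 < d)%N /\ (0 < k)%N by apply/andP; rewrite -muln_gt0.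
have cardQ : #|{: Q}| = (d * k)%N by rewrite card_prod card_ord card_box dk mulnC.
have cardQ' : #|{: Q}| = (k * d)%N by rewrite cardQ mulnC.
have [e e_bij] : exists e : Q -> 'I_d * 'I_k, bijective e.
  have E : #|{: Q}| = #|{: 'I_d * 'I_k}| by rewrite cardQ card_prod !card_ord.
  exists (fun q => enum_val (cast_ord E (enum_rank q))).
  by exists (fun ij => enum_val (cast_ord (esym E) (enum_rank ij))) => z;
    rewrite enum_valK ?cast_ordK ?cast_ordKV enum_rankK.
pose e' q := ((e q).2, (e q).1).
have e'_bij : bijective e'.
  case: e_bij => f ef fe; exists (fun ji => f (ji.2, ji.1)) => [q|[j i]].
    by rewrite /e' /= -surjective_pairing.
  by rewrite /e' fe.
pose P := wedge_pairing C e.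
have Psign := wedge_pairing_sign C e : forall p s a, P _ _ = _.
have P'E s a : wedge_pairing C e' a s = P s a := wedge_pairing_swap C e s a.
have Pnz := wedge_pairing_neq0 C (bij_inj e_bij).
have [delta deltaP] := wedge_pairing_eigen C e_bij.
have [delta' delta'P] := wedge_pairing_eigen C e'_bij.
have [c c_neq0 cP] := first_fundamental_theorem d_gt0 cardQ (@reindex_word_bij _ _) Psign deltaP
  (wedge_pairing_real C e) Pnz.
have [c' c'_neq0 c'P] := first_fundamental_theorem k_gt0 cardQ' (@reindex_word_bij _ _)
  (wedge_pairing_sign C e') delta'P
  (wedge_pairing_real C e') (wedge_pairing_neq0 C (bij_inj e'_bij)).
pose Y := @CS_wedge C mu k.
pose x0 t := \sum_a P t a * Y a.
have deltaE g : delta g = \det g ^+ k by apply: (eigen_det d_gt0 cardQ (deltaP _) Pnz).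
have Yinv g a : tact g Y a = \det g ^+ d * Y a.
  have [eta etaP] := CS_wedge_eigen C k mu_sorted.
  by rewrite etaP (eigen_det k_gt0 cardQ' etaP (CS_wedge_neq0 C mu k)).
have left_sign (p : {perm 'I_n}) : (-1) ^+ left_perm (box mu) p = (-1) ^+ p :> C.
  by rewrite odd_left_perm card_box -exprM -signr_odd oddM mu_odd andbT oddb.
exists x0; split.
- split.
  + apply: (in_young_power_pairing (P := fun a t => P t a) (f := fun _ r => (-1) ^+ r)).
    * by move=> r a s; apply: Psign.
    * by move=> s r; rewrite odd_permM signr_addb mulrA -expr2 sqrr_sign mul1r.
    * exact: CS_wedge_in.
  + move=> p t; rewrite /x0.
    rewrite (reindex_inj (bij_inj (reindex_word_bij _ (left_perm (box mu) p)))) /=.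
    apply: eq_bigr => a _; rewrite Psign left_sign /Y CS_wedge_alternating mulrACA.
    by rewrite -expr2 sqrr_sign mul1r.
  + move=> g _ t; rewrite /x0 mulr_sumr /tact.
    under eq_bigr => s _ do rewrite mulr_suml.
    rewrite exchange_big /=; apply: eq_bigr => a _; rewrite mulrA -deltaE -deltaP.
    by rewrite /tact mulr_suml; apply: eq_bigr => s _; rewrite mulrAC.
- case: (pickP (fun t => x0 t != 0)) => [t xt|x0_eq0]; first by exists t.
  (* If [x0], that is P Y, were zero, then so would be P^T P Y, which is the non-zero multiple [c']
     of Y. *)
  have /eqP := c'P _ (fun g _ a => Yinv g a) (join (@CS_word mu k)).
  rewrite big1 => [|t _]; last first.
    rewrite [X in _ * X](_ : _ = x0 t); last by apply: eq_bigr => a _; rewrite P'E.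
    by have /negbT := x0_eq0 t; rewrite negbK => /eqP ->; rewrite mulr0.
  by rewrite eq_sym mulf_eq0 (negPf c'_neq0) (negPf (CS_wedge_neq0 C mu k)).
(* Here y = P^T x lies on the line of Y, say y = lambda Y, and applying P gives c x = lambda
   [x0]. *)
- move=> x [xin xsym xinv]; pose y a := \sum_s P s a * x s.
  have yin : in_young_power (fun _ r => (-1) ^+ r) y.
    apply: (in_young_power_pairing Psign _ xin) => s r.
    by rewrite odd_permM addbC signr_addb mulrA -expr2 sqrr_sign mul1r.
  have yalt : alternating y.
    move=> p a; rewrite /y mulr_sumr.
    rewrite (reindex_inj (bij_inj (reindex_word_bij _ (left_perm (box mu) p)))) /=.
    by apply: eq_bigr => s _; rewrite Psign left_sign xsym mulrA.
  have [lambda lP] := alternating_unique mu_sorted yalt yin.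
  exists (c^-1 * lambda) => t; apply: (mulfI c_neq0).
  rewrite -cP // -mulrA mulVKf // mulr_sumr; apply: eq_bigr => a _.
  by rewrite -/(y a) lP mulrCA.
Qed.
End Invariants.

(** * The Schur functor and its symmetric powers in coordinates *)

Lemma span_image (K : fieldType) (V : vectType K) (T : finType) (f : T -> V) v :
  v \in <<[seq f t | t : T]>>%VS -> exists c : T -> K, v = \sum_t c t *: f t.
Proof.
have sz : size [seq f t | t : T] == #|T| by rewrite size_map -cardE.
move=> /(@coord_span _ _ _ (Tuple sz)) E.
exists (fun t => coord (Tuple sz) (enum_rank t) v); rewrite {1}E.
rewrite (reindex (@enum_rank T)) /=; last exact/onW_bij/enum_rank_bij.
apply: eq_bigr => t _; congr (_ *: _).
by rewrite nth_image enum_rankK.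
Qed.

Section Coordinates.
Variables (K : fieldType) (E : vectType K).
Local Notation d := (\dim {:E}).
Local Notation eb := (vbasis {:E}).

Lemma coord_basis_vec (i j : 'I_d) : coord eb i eb`_j = (i == j)%:R.
Proof. by rewrite (coord_free _ _ (basis_free (vbasisP _))) eq_sym. Qed.

Definition act_mx (g : 'End(E)) : 'M[K]_d := \matrix_(i, j) coord eb i (g eb`_j).

Lemma act_mx_surj (A : 'M[K]_d) : exists g, act_mx g = A.
Proof.
exists (passmx.hommx eb eb A^T); apply/matrixP => i j.
have := congr1 (fun M : 'M_d => M j i) (passmx.hommxK (vbasisP {:E}) (vbasisP {:E}) A^T).
by rewrite !mxE /= passmx.vecof_delta.
Qed.

Variable B : finType.
Local Notation word := {ffun B -> 'I_d}.

Lemma pure_tensor_basis (u t : word) :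
  pure_tensor (fun b => eb`_(u b)) t = (t == u)%:R.
Proof.
rewrite ffunE; case: eqP => [->|/eqP ne].
  by rewrite big1 // => b _; rewrite coord_basis_vec eqxx.
have [/forallP h|] := boolP [forall b, t b == u b].
  by case/eqP: ne; apply/ffunP => b; apply/eqP.
rewrite negb_forall => /existsP [b /negPf tu].
by rewrite (bigD1 b) //= coord_basis_vec tu mul0r.
Qed.

(** The transpose reconciles [tact], which acts on row vectors, with the columns of [act_mx]. *)
Lemma tensor_actE g (x : tensor E B) (t : word) :
  tensor_act g x t = tact (act_mx g)^T (x : word -> K) t.
Proof.
rewrite /tensor_act sum_ffunE; apply: eq_bigr => u _.
rewrite ffunE; congr (_ * _); rewrite ffunE.
by apply: eq_bigr => b _; rewrite !mxE.
Qed.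

End Coordinates.

Section Nabla.
Variables (K : numFieldType) (E : vectType K) (mu : seq nat).
Local Notation d := (\dim {:E}).
Local Notation eb := (vbasis {:E}).
Local Notation V := (nabla mu E).
Local Notation word := {ffun box mu -> 'I_d}.

Definition young_cols (u t : word) : K := young (fun s _ => (-1) ^+ s) u t.

Lemma polytabloid_basis (u t : word) :
  polytabloid (fun b => eb`_(u b)) t = young_cols u t.
Proof.
rewrite /polytabloid sum_ffunE; apply: eq_bigr => s _.
rewrite sum_ffunE; apply: eq_bigr => r _; rewrite ffunE; congr (_ * _).
rewrite -pure_tensor_basis; congr ((_ : tensor E (box mu)) t).
rewrite /pure_tensor; apply/ffunP => w; rewrite !ffunE.
by apply: eq_bigr => b _; rewrite ffunE permM.
Qed.

Lemma nablaP (x : tensor E (box mu)) :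
  reflect (exists c : word -> K, forall t : word, x t = \sum_u c u * young_cols u t) (x \in V).
Proof.
apply: (iffP idP) => [/span_image [c ->]|[c xE]].
  exists c => t; rewrite sum_ffunE; apply: eq_bigr => u _.
  by rewrite ffunE -polytabloid_basis.
rewrite (_ : x = \sum_u c u *: polytabloid (fun b => eb`_(u b))).
  rewrite rpred_sum // => u _; rewrite rpredZ // memv_span //.
  by apply/imageP; exists u.
apply/ffunP => t; rewrite sum_ffunE xE; apply: eq_bigr => u _.
by rewrite ffunE -polytabloid_basis.
Qed.

Lemma tensor_act_nabla g x : x \in V -> tensor_act g x \in V.
Proof.
case/nablaP => c xE; apply/nablaP.
exists (fun v => \sum_u c u * \prod_q (act_mx g)^T (u q) (v q)) => t.
rewrite tensor_actE (eq_tact _ xE) /tact.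
under eq_bigr => s _ do rewrite mulr_suml.
under [RHS]eq_bigr => v _ do rewrite mulr_suml.
rewrite exchange_big [RHS]exchange_big /=; apply: eq_bigr => u _.
under eq_bigr => v _ do rewrite -mulrA.
under [RHS]eq_bigr => v _ do rewrite -mulrA.
rewrite -!mulr_sumr; congr (_ * _).
under [RHS]eq_bigr => v _ do rewrite /young_cols young_perm_kernel.
rewrite -tact_perm_kernel /tact; apply: eq_bigr => v _.
by rewrite /young_cols young_perm_kernel.
Qed.

End Nabla.

(** * Homogeneous polynomials as symmetric families of coefficients *)

Lemma multinom_sum_units (n D : nat) (m : 'X_{1..D}) : mdeg m = n ->
  exists i : {ffun 'I_n -> 'I_D}, (\sum_nu U_(i nu))%MM = m.
Proof.
elim: n m => [|n IH] m mn.
  have v : 'I_0 -> 'I_D by case.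
  by exists [ffun nu => v nu]; rewrite big_ord0; apply/esym/eqP; rewrite -mdeg_eq0 mn.
have [j mj] : exists j, (0 < m j)%N.
  apply/existsP; apply: contraPT (mn) => /existsPn m0.
  by rewrite mdegE big1 // => j _; apply/eqP; have := m0 j; rewrite -eqn0Ngt.
have mE : m = (U_(j) + (m - U_(j)))%MM.
  by rewrite addmC submK //; apply/mnm_lepP => l; rewrite mnm1E; case: eqP => // <-.
have [|i iE] := IH (m - U_(j))%MM.
  by move: mn; rewrite {1}mE mdegD mdeg1 => -[].
exists [ffun nu => if unlift ord0 nu is Some nu' then i nu' else j].
rewrite big_ord_recl ffunE unlift_none [RHS]mE -iE; congr (_ + _)%MM.
by apply: eq_bigr => nu _; rewrite ffunE liftK.
Qed.

Section SymmetricCoefficients.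
Variables (K : numFieldType) (n D : nat).
Local Notation index := {ffun 'I_n -> 'I_D}.

Definition symmetric_coef (c : index -> K) :=
  forall (p : {perm 'I_n}) i, c (reindex_word i p) = c i.

Definition poly_of_coef (c : index -> K) : {mpoly K[D]} :=
  \sum_i c i *: 'X_[(\sum_nu U_(i nu))%MM].

Let content (i : index) : 'X_{1..D} := (\sum_nu U_(i nu))%MM.

Let mdeg_content i : mdeg (content i) = n.
Proof.
rewrite mdeg_sum (eq_bigr (fun=> 1%N)) => [|nu _]; last exact: mdeg1.
by rewrite sum1_card card_ord.
Qed.

Let content_onto m : mdeg m = n -> exists i, content i = m.
Proof. exact: multinom_sum_units. Qed.

Let content_eq i j : content i = content j -> exists p : {perm 'I_n}, j = reindex_word i p.
Proof.
move=> E; apply: reindex_word_eq => y.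
have cnt (l : index) : #|[set nu | l nu == y]| = content l y.
  rewrite /content mnm_sumE -sum1_card big_mkcond /=.
  by apply: eq_bigr => nu _; rewrite mnm1E inE; case: eqP.
by rewrite !cnt E.
Qed.

Lemma poly_of_coef_homog c : poly_of_coef c \is n.-homog.
Proof.
by apply: rpred_sum => i _; apply: rpredZ; rewrite dhomogX /= mdeg_content.
Qed.

Let fibre_size (m : 'X_{1..D}) := #|[set i | content i == m]|.

Let fibre_neq0 i : (fibre_size (content i))%:R != 0 :> K.
Proof.
by rewrite pnatr_eq0 -lt0n; apply/card_gt0P; exists i; rewrite inE.
Qed.

Let mcoeff_poly_of_coef c i : symmetric_coef c ->
  (poly_of_coef c)@_(content i) = (fibre_size (content i))%:R * c i.
Proof.
move=> csym; rewrite /poly_of_coef raddf_sum /= (bigID (mem [set j | content j == content i])) /=.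
rewrite [X in _ + X]big1 ?addr0 => [|j]; last first.
  by rewrite inE mcoeffZ mcoeffX => /negPf ->; rewrite mulr0.
rewrite (eq_bigr (fun=> c i)) ?sumr_const ?mulr_natl // => j; rewrite inE => /eqP E.
rewrite mcoeffZ mcoeffX -/(content j) E eqxx mulr1.
by have [p ->] := content_eq (esym E).
Qed.

Lemma poly_of_coef_eq0 c : symmetric_coef c -> poly_of_coef c = 0 -> forall i, c i = 0.
Proof.
move=> csym c0 i; have := mcoeff_poly_of_coef i csym; rewrite c0 mcoeff0 => /esym/eqP.
by rewrite mulf_eq0 (negPf (fibre_neq0 i)) => /eqP.
Qed.

(** Each coefficient is spread evenly over the index words of its monomial, dividing by their
    number; this uses characteristic zero. *)
Lemma homog_poly_of_coef (p : {mpoly K[D]}) : p \is n.-homog ->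
  exists c, symmetric_coef c /\ p = poly_of_coef c.
Proof.
move=> ph; pose c i := p@_(content i) / (fibre_size (content i))%:R.
have csym : symmetric_coef c.
  move=> q i; rewrite /c (_ : content (reindex_word i q) = content i) //.
  rewrite /content [RHS](reindex_inj (@perm_inj _ q)) /=.
  by apply: eq_bigr => nu _; rewrite ffunE.
exists c; split=> //; apply/mpolyP => m.
have [/content_onto [i <-]|m_n] := eqVneq (mdeg m) n.
  by rewrite mcoeff_poly_of_coef // mulrC divfK.
by rewrite !(dhomog_nemf_coeff _ m_n) // poly_of_coef_homog.
Qed.

Lemma poly_of_coefB c c' : poly_of_coef (fun i => c i - c' i) = poly_of_coef c - poly_of_coef c'.
Proof. by rewrite -sumrB; apply: eq_bigr => i _; rewrite scalerBl. Qed.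

Lemma poly_of_coef_inj c c' : symmetric_coef c -> symmetric_coef c' ->
  poly_of_coef c = poly_of_coef c' -> c =1 c'.
Proof.
move=> cs c's E i; apply/eqP; rewrite -subr_eq0; apply/eqP.
apply: (poly_of_coef_eq0 (c := fun i => c i - c' i)).
  by move=> p j; rewrite cs c's.
by rewrite poly_of_coefB E subrr.
Qed.

Lemma poly_of_coefZ a c : poly_of_coef (fun i => a * c i) = a *: poly_of_coef c.
Proof. by rewrite scaler_sumr; apply: eq_bigr => i _; rewrite scalerA. Qed.

Lemma eq_poly_of_coef c c' : c =1 c' -> poly_of_coef c = poly_of_coef c'.
Proof. by move=> E; apply: eq_bigr => i _; rewrite E. Qed.

Lemma comp_poly_of_coef (rho : 'M[K]_D) c :
  comp_mpoly [tuple \sum_(j < D) rho i j *: 'X_j | i < D] (poly_of_coef c)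
  = poly_of_coef (tact rho c).
Proof.
rewrite /poly_of_coef raddf_sum /=.
transitivity (\sum_i \sum_(j : index) (c i * \prod_nu rho (i nu) (j nu)) *: 'X_[content j]).
  apply: eq_bigr => i _; rewrite comp_mpolyZ -mprodXE rmorph_prod /=.
  rewrite (eq_bigr (fun nu => \sum_(j < D) rho (i nu) j *: 'X_j)) => [|nu _]; last first.
    by rewrite comp_mpolyXU -tnth_nth tnth_mktuple.
  rewrite (bigA_distr_bigA (fun nu j => rho (i nu) j *: 'X_j)) scaler_sumr.
  apply: eq_bigr => j _; rewrite -scalerA; congr (_ *: _).
  by rewrite scaler_prod /content -mprodXE.
rewrite exchange_big /=; apply: eq_bigr => j _.
by rewrite -scaler_suml.
Qed.

Lemma tact_symmetric (rho : 'M[K]_D) c : symmetric_coef c -> symmetric_coef (tact rho c).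
Proof.
move=> csym p i; rewrite /tact.
rewrite (reindex_inj (bij_inj (reindex_word_bij _ p))) /=.
apply: eq_bigr => s _; rewrite csym; congr (_ * _).
rewrite [RHS](reindex_inj (@perm_inj _ p)) /=.
by apply: eq_bigr => q _; rewrite !ffunE.
Qed.

End SymmetricCoefficients.

Section SymmetricTensors.
Variables (K : numFieldType) (E : vectType K) (mu : seq nat) (n : nat).
Local Notation d := (\dim {:E}).
Local Notation V := (nabla mu E).
Local Notation vb := (vbasis V).
Local Notation B := (box mu).
Local Notation index := {ffun 'I_n -> 'I_(\dim V)}.
Local Notation word := {ffun 'I_n * B -> 'I_d}.

Definition nabla_basis (i : 'I_(\dim V)) (t : {ffun B -> 'I_d}) : K := (vb`_i : tensor E B) t.

Definition tensor_of_coef (c : index -> K) (t : word) : K :=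
  \sum_i c i * \prod_nu nabla_basis (i nu) (slot t nu).

Lemma nabla_basis_expand x : x \in V ->
  forall t : {ffun B -> 'I_d}, (x : tensor E B) t = \sum_j coord vb j x * nabla_basis j t.
Proof.
move=> xV t; rewrite {1}(coord_vbasis xV) sum_ffunE; apply: eq_bigr => j _.
by rewrite ffunE.
Qed.

Lemma tensor_of_coefK (c : index -> K) : exists w : 'I_(\dim V) -> {ffun B -> 'I_d} -> K,
  forall j, c j = \sum_t tensor_of_coef c t * \prod_nu w (j nu) (slot t nu).
Proof.
pose delta u : tensor E B := [ffun t : {ffun B -> 'I_d} => (t == u)%:R : K^o].
(* The coordinate functionals of the Schur functor are defined on the whole tensor space, so their
   values on basis tensors give a family dual to [nabla_basis]. *)
pose w j u := coord vb j (delta u).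
have wP i j : \sum_u nabla_basis i u * w j u = (i == j)%:R.
  rewrite -(coord_free i j (basis_free (vbasisP V))).
  have E1 : vb`_i = \sum_u nabla_basis i u *: delta u.
    apply/ffunP => t; rewrite sum_ffunE (bigD1 t) //= !ffunE eqxx big1 => [|u ut].
      by rewrite addr0 [RHS]mulr1.
    by rewrite !ffunE eq_sym (negPf ut) [LHS]mulr0.
  by rewrite [in RHS]E1 linear_sum; apply: eq_bigr => u _; rewrite linearZ.
exists w => j; under eq_bigr => t _ do rewrite /tensor_of_coef mulr_suml.
rewrite exchange_big /=.
transitivity (\sum_i c i * \prod_nu (i nu == j nu)%:R).
  rewrite (bigD1 j) //= [X in _ * X]big1 ?mulr1 => [|nu _]; last by rewrite eqxx.
  rewrite big1 ?addr0 // => i ij.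
  have [/forallP h|] := boolP [forall nu, i nu == j nu].
    by case/eqP: ij; apply/ffunP => nu; apply/eqP.
  by rewrite negb_forall => /existsP [nu /negPf ne]; rewrite (bigD1 nu) //= ne mul0r mulr0.
apply: eq_bigr => i _; under [RHS]eq_bigr => t _ do rewrite -mulrA -big_split /=.
rewrite -mulr_sumr; congr (_ * _).
rewrite -(prod_sum_slots (fun nu u => nabla_basis (i nu) u * w (j nu) u)).
by apply: eq_bigr => nu _; rewrite wP.
Qed.

Lemma tensor_of_coef_inj c c' : tensor_of_coef c =1 tensor_of_coef c' -> c =1 c'.
Proof.
move=> E' j.
pose c'' i := c i - c' i.
have [w wP] := tensor_of_coefK c''.
apply/eqP; rewrite -subr_eq0 -/(c'' j) wP big1 // => t _.
have -> : tensor_of_coef c'' t = tensor_of_coef c t - tensor_of_coef c' t.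
  by rewrite -sumrB; apply: eq_bigr => i _; rewrite mulrBl.
by rewrite E' subrr mul0r.
Qed.

Lemma eq_tensor_of_coef c c' : c =1 c' -> tensor_of_coef c =1 tensor_of_coef c'.
Proof. by move=> E' t; apply: eq_bigr => i _; rewrite E'. Qed.

Lemma tensor_of_coefZ a c t : tensor_of_coef (fun i => a * c i) t = a * tensor_of_coef c t.
Proof. by rewrite mulr_sumr; apply: eq_bigr => i _; rewrite mulrA. Qed.

Lemma tensor_of_coef_in c : in_young_power (fun s _ => (-1) ^+ s) (tensor_of_coef c).
Proof.
have expand (i : 'I_(\dim V)) : exists e : {ffun B -> 'I_d} -> K, forall t,
    nabla_basis i t = \sum_u e u * young_cols u t.
  by apply/nablaP/vbasis_mem/mem_nth; rewrite size_tuple.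
have [e eP] := fin_all_exists expand.
exists (fun T => \sum_i c i * \prod_nu e (i nu) (slot T nu)) => t.
under [RHS]eq_bigr => T _ do rewrite mulr_suml.
rewrite exchange_big /=; apply: eq_bigr => i _.
under [RHS]eq_bigr => T _ do rewrite -mulrA -big_split /=.
rewrite -mulr_sumr; congr (_ * _).
rewrite -(prod_sum_slots (fun nu u => e (i nu) u * young_cols u (slot t nu))).
by apply: eq_bigr => nu _; rewrite eP.
Qed.

Lemma tensor_of_coef_onto x : in_young_power (fun s _ => (-1) ^+ s) x ->
  exists c, x =1 tensor_of_coef c.
Proof.
case=> c0 xE.
have expand (u : {ffun B -> 'I_d}) : exists e : 'I_(\dim V) -> K, forall t,
    young_cols u t = \sum_j e j * nabla_basis j t.
  pose z : tensor E B := [ffun t => young_cols u t : K^o].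
  have zV : z \in V.
    apply/nablaP; exists (fun v => (v == u)%:R) => t.
    rewrite (bigD1 u) //= eqxx mul1r big1 ?addr0 ?ffunE // => v /negPf ->.
    by rewrite mul0r.
  by exists (fun j => coord vb j z) => t; rewrite -nabla_basis_expand // ffunE.
have [e eP] := fin_all_exists expand.
exists (fun i => \sum_T c0 T * \prod_nu e (slot T nu) (i nu)) => t; rewrite xE.
under [RHS]eq_bigr => i _ do rewrite mulr_suml.
rewrite exchange_big /=; apply: eq_bigr => T _.
under [RHS]eq_bigr => i _ do rewrite -mulrA -big_split /=.
rewrite -mulr_sumr; congr (_ * _).
rewrite -(bigA_distr_bigA (fun nu j => e (slot T nu) j * nabla_basis j (slot t nu))).
by apply: eq_bigr => nu _; exact: eP.
Qed.

Lemma tensor_of_coef_perm c (p : {perm 'I_n}) t :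
  tensor_of_coef c (reindex_word t (left_perm B p)) =
  tensor_of_coef (fun i => c (reindex_word i p)) t.
Proof.
rewrite /tensor_of_coef (reindex_inj (bij_inj (reindex_word_bij _ p))) /=.
apply: eq_bigr => i _; congr (_ * _).
rewrite [RHS](reindex_inj (@perm_inj _ p)) /=.
by apply: eq_bigr => nu _; rewrite slot_left_perm ffunE.
Qed.

(** Images are stored in rows, as in the substitution of [sym_act], so no transpose appears on
    coefficients. *)
Definition nabla_mx (g : 'End(E)) : 'M[K]_(\dim V) :=
  \matrix_(i, j) coord vb j (tensor_act g vb`_i).

Lemma tact_tensor_of_coef g c t :
  tact (act_mx g)^T (tensor_of_coef c) t = tensor_of_coef (tact (nabla_mx g) c) t.
Proof.
rewrite /tact /tensor_of_coef.
under eq_bigr => s _ do rewrite mulr_suml.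
under [RHS]eq_bigr => j _ do rewrite mulr_suml.
rewrite exchange_big [RHS]exchange_big /=; apply: eq_bigr => i _.
under eq_bigr => s _ do rewrite -mulrA.
under [RHS]eq_bigr => s _ do rewrite -mulrA -big_split /=.
rewrite -!mulr_sumr; congr (_ * _).
rewrite -(bigA_distr_bigA (fun nu j => nabla_mx g (i nu) j * nabla_basis j (slot t nu))).
transitivity (\sum_(s : word) \prod_nu (nabla_basis (i nu) (slot s nu) *
    \prod_b (act_mx g)^T (slot s nu b) (slot t nu b))).
  apply: eq_bigr => s _; rewrite big_split /=; congr (_ * _).
  rewrite pair_bigA /=; apply: eq_bigr => -[nu b] _ /=.
  by rewrite !ffunE.
rewrite -(prod_sum_slots (fun nu u => nabla_basis (i nu) u * \prod_b (act_mx g)^T (u b) (slot t nu b))).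
apply: eq_bigr => nu _.
have viV : vb`_(i nu) \in V by apply/vbasis_mem/mem_nth; rewrite size_tuple.
have := nabla_basis_expand (tensor_act_nabla g viV) (slot t nu).
rewrite tensor_actE /tact => E1; rewrite [LHS]E1.
by apply: eq_bigr => j _; rewrite mxE.
Qed.

Lemma sym_act_poly_of_coef g (c : index -> K) :
  sym_act (U := V) (tensor_act g) (poly_of_coef c) = poly_of_coef (tact (nabla_mx g) c).
Proof.
rewrite -comp_poly_of_coef /sym_act; congr (comp_mpoly _ _).
apply: eq_from_tnth => i; rewrite !tnth_mktuple; apply: eq_bigr => j _.
by rewrite mxE.
Qed.

End SymmetricTensors.

Lemma in_SL_act_mx (K : fieldType) (E : vectType K) (g : 'End(E)) :
  in_SL g <-> \det (act_mx g) = 1.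
Proof. by []. Qed.

(** * From SL-invariant polynomials to semi-invariant tensors *)

Section Transfer.
Variables (K : numClosedFieldType) (E : vectType K) (mu : seq nat) (k : nat).
Local Notation n := #|CS mu k|.
Local Notation d := (\dim {:E}).
Local Notation V := (nabla mu E).
Hypotheses (d_gt0 : (0 < d)%N) (dk : (d * k = sumn mu * n)%N).

Lemma SL_invariant_tensor (c : {ffun 'I_n -> 'I_(\dim V)} -> K) : symmetric_coef c ->
  SL_invariant n (poly_of_coef c) <-> tensor_invariant (tensor_of_coef c).
Proof.
move=> csym; split=> [[_ inv]|[_ _ inv]].
- split.
  + exact: tensor_of_coef_in.
  + by move=> p t; rewrite tensor_of_coef_perm; apply: eq_tensor_of_coef => i; rewrite csym.
  + have invSL g t : \det g = 1 -> tact g (tensor_of_coef c) t = tensor_of_coef c t.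
      move=> g1; have [h hE] := act_mx_surj g^T.
      rewrite -[g]trmxK -hE tact_tensor_of_coef; apply: eq_tensor_of_coef => i.
      have /inv : in_SL h by rewrite in_SL_act_mx hE det_tr.
      rewrite sym_act_poly_of_coef => /poly_of_coef_inj; apply => //.
      exact: tact_symmetric.
    (* Factor [g] as the scalar [l] times a matrix of determinant 1. The scalar acts by [l] to the
       power [#|Q|], which is d k, hence by the k-th power of the determinant. *)
    move=> g gu t; pose l := d.-root (\det g).
    have lE : l ^+ d = \det g by rewrite rootCK.
    have l0 : l != 0.
      by apply: contraTneq gu => l0; rewrite unitmxE -lE l0 expr0n gtn_eqF // unitr0.
    have -> : g = l *: (l^-1 *: g) by rewrite scalerA divff ?scale1r.
    rewrite tact_scale invSL; last by rewrite detZ exprVn lE mulVf // -lE expf_neq0.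
    rewrite scalerA divff // scale1r -lE -exprM; congr (_ ^+ _ * _).
    by rewrite card_prod card_ord card_box dk mulnC.
- split; first exact: poly_of_coef_homog.
  move=> g /in_SL_act_mx g1; rewrite sym_act_poly_of_coef; apply: eq_poly_of_coef.
  apply: tensor_of_coef_inj => t; rewrite -tact_tensor_of_coef inv ?det_tr ?g1 ?expr1n ?mul1r //.
  by rewrite unitmxE det_tr g1 unitr1.
Qed.

End Transfer.

Theorem corollary9p11 (R : realType) (k m n d : nat) (mu : seq nat)
    (hmu : is_partition m mu) (hm : odd m)
    (hn : n = #|CS mu k|) (hn1 : (1 <= n)%N)
    (hd : (d * k = m * n)%N)
    (E : vectType R[i]) (hE : \dim {:E} = d) :
  exists f : {mpoly R[i][\dim (nabla mu E)]},
    [/\ f != 0, SL_invariant n f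
      & forall h : {mpoly R[i][\dim (nabla mu E)]},
          SL_invariant n h -> exists c : R[i], h = c *: f].
Proof.
case: hmu => mu_sorted _ mu_m; subst m n d.
have d_gt0 : (0 < \dim {:E})%N.
  have : (0 < \dim {:E} * k)%N by rewrite hd muln_gt0 hn1 odd_gt0.
  by rewrite muln_gt0 => /andP [].
have [x [xinv [t xt] xuniq]] := tensor_invariant_unique R[i] mu_sorted hm hn1 hd.
have [xin xsym _] := xinv; have [c xE] := tensor_of_coef_onto xin.
(* Uniqueness of coefficients turns the symmetry of the tensor [x] into symmetry of [c]. *)
have csym : symmetric_coef c.
  move=> p; apply: tensor_of_coef_inj => u.
  by rewrite -tensor_of_coef_perm -!xE xsym.
have cinv : tensor_invariant (tensor_of_coef c).
  case: xinv => _ _ xact; split; first exact: tensor_of_coef_in.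
    by move=> p u; rewrite -!xE xsym.
  by move=> g gu u; rewrite -xE -xact //; apply: eq_tact => v; rewrite xE.
exists (poly_of_coef c); split.
- apply: contra_neq xt => /(poly_of_coef_eq0 csym) c0.
  by rewrite xE /tensor_of_coef big1 // => i _; rewrite c0 mul0r.
- exact/SL_invariant_tensor.
- move=> h hinv; have [h' [h'sym hE]] := homog_poly_of_coef hinv.1.
  rewrite hE in hinv *; have /xuniq [lambda lP] := iffLR (SL_invariant_tensor d_gt0 hd h'sym) hinv.
  exists lambda; rewrite -poly_of_coefZ; apply: eq_poly_of_coef.
  by apply: tensor_of_coef_inj => u; rewrite lP tensor_of_coefZ xE.
Qed.
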